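(* Let $M$ be a Fano manifold of complex dimension $n$, $\omega_0\in c_1(M)$ a smooth Kähler metric, $D\in|-\lambda K_M|$ a smooth divisor with $\lambda>1$ rational, and let $\hat\omega\in c_1(M)$ be a Kähler current with $L^p$-density with respect to $\omega_0^n$ for some $p>1$ and $\int_M\hat\omega^n=\int_M\omega_0^n$. Let $\omega_{\gamma,\varepsilon}(t)$ be the solution of the twisted Kähler-Ricci flow $(TKRF_{\mu_\gamma,\varepsilon})$ with initial value $\hat\omega$. Then for any $\mu_\gamma\in[0,1]$, $\varepsilon>0$ and $t\geqslant1$, $$R(\omega_{\gamma,\varepsilon}(t))-(1-\gamma)tr_{\omega_{\gamma,\varepsilon}(t)}\theta_\varepsilon\geqslant-4n.$$
   Context: $Ric(\omega)=-\sqrt{-1}\partial\bar\partial\log\omega^n$ represents $c_1(M)$, $R(\omega)=tr_\omega Ric(\omega)$. $s$ is the defining section of $D$, $h$ a smooth Hermitian metric on $-\lambda K_M$ with curvature $\lambda\omega_0$, rescaled so that $|s|_h^2<\frac12$. $\mu_\gamma=1-(1-\gamma)\lambda$ for $\gamma\in[1-\frac1\lambda,1]$, and $\theta_\varepsilon=\lambda\omega_0+\sqrt{-1}\partial\bar\partial\log(\varepsilon^2+|s|_h^2)$ (a smooth closed positive $(1,1)$-form). Write $\hat\omega=\omega_0+\sqrt{-1}\partial\bar\partial\varphi_0$. $(TKRF_{\mu_\gamma,\varepsilon})$: $\frac{\partial\omega_{\gamma,\varepsilon}(t)}{\partial t}=-Ric(\omega_{\gamma,\varepsilon}(t))+\mu_\gamma\omega_{\gamma,\varepsilon}(t)+(1-\gamma)\theta_\varepsilon$,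 $\omega_{\gamma,\varepsilon}(0)=\hat\omega$. It has a unique long-time solution: smooth on $(0,\infty)\times M$, $\omega_{\gamma,\varepsilon}(t)=\omega_0+\sqrt{-1}\partial\bar\partial\varphi_{\gamma,\varepsilon}(t)$ with $\varphi_{\gamma,\varepsilon}\in C^0([0,\infty)\times M)\cap C^\infty((0,\infty)\times M)$ and $\|\varphi_{\gamma,\varepsilon}(t)-\varphi_0\|_{L^\infty}\to0$ as $t\to0^+$. *)

(* Defs.v *)
From HB Require Import structures.
From mathcomp Require Import all_boot all_order all_algebra complex.
From mathcomp Require Import sesquilinear spectral.
From mathcomp Require Import all_classical all_reals all_analysis.

Set Implicit Arguments.
Unset Strict Implicit.
Unset Printing Implicit Defensive.

Import Order.TTheory GRing.Theory Num.Theory.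
Import numFieldNormedType.Exports.

Local Open Scope classical_set_scope.
Local Open Scope ring_scope.
Local Open Scope complex_scope.
Local Open Scope sesquilinear_scope.

(* C^n is R^n * R^n, the pair (x, y) standing for x + sqrt(-1) y; it is a
   normed space over R, so that the library's directional derivatives 'D_v
   are the real ones. *)
Definition Cn (R : realType) (n : nat) : normedModType R :=
  ('rV[R]_n * 'rV[R]_n)%type.

Section Calculus.
Context {R : realType}.

Fixpoint Ck {V : normedModType R} (k : nat) (U : set V) (f : V -> R) : Prop :=
  (forall x, U x -> {for x, continuous f}) /\
  (if k is k'.+1 then
     forall v : V, (forall x, U x -> derivable f x v) /\
                   Ck k' U (fun x => 'D_v f x)
   else True).

Definition smooth_on {V : normedModType R} (U : set V) (f : V -> R) : Prop :=
  forall k, Ck k U f.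

Definition csmooth_on {V : normedModType R} (U : set V) (F : V -> R[i]) :=
  smooth_on U (fun x => complex.Re (F x)) /\
  smooth_on U (fun x => complex.Im (F x)).

Definition cderive {V : normedModType R} (v : V) (F : V -> R[i]) (x : V)
    : R[i] :=
  ('D_v (fun y => complex.Re (F y)) x) +i* ('D_v (fun y => complex.Im (F y)) x).

Definition sqmod (z : R[i]) : R := complex.Re z ^+ 2 + complex.Im z ^+ 2.

Context {n : nat}.
Implicit Types (U : set (Cn R n)) (F : Cn R n -> R[i]) (a b : 'I_n).

Definition coordC (z : Cn R n) a : R[i] := (z.1 0 a) +i* (z.2 0 a).

Definition xdir a : Cn R n := (delta_mx 0 a, 0).
Definition ydir a : Cn R n := (0, delta_mx 0 a).

(* d/dz_a and d/d(conj z_a) *)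
Definition dz a F z : R[i] :=
  2^-1 * (cderive (xdir a) F z - 'i * cderive (ydir a) F z).
Definition dzbar a F z : R[i] :=
  2^-1 * (cderive (xdir a) F z + 'i * cderive (ydir a) F z).

Definition holomorphic_on U F : Prop :=
  csmooth_on U F /\ forall a z, U z -> dzbar a F z = 0.

(* A real (1,1)-form sqrt(-1) sum_{a,b} G_{ab} dz_a /\ d(conj z_b) is given by
   its hermitian matrix G; this is the matrix of sqrt(-1) ddbar u. *)
Definition ddbar (u : Cn R n -> R) (z : Cn R n) : 'M[R[i]]_n :=
  \matrix_(a, b) dz a (dzbar b (fun w => (u w)%:C)) z.

(* Ric(omega) = - sqrt(-1) ddbar log omega^n; omega^n is det G up to a constant
   multiple of the Euclidean volume form. *)
Definition Ric (G : Cn R n -> 'M[R[i]]_n) (z : Cn R n) : 'M[R[i]]_n :=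
  - ddbar (fun w => ln (complex.Re (\det (G w)))) z.

Definition tr_form (omega alpha : 'M[R[i]]_n) : R :=
  complex.Re (\tr (invmx omega *m alpha)).

Definition scalar_curv (G : Cn R n -> 'M[R[i]]_n) (z : Cn R n) : R :=
  tr_form (G z) (Ric G z).

Definition herm_psd (A : 'M[R[i]]_n) : Prop :=
  A \is hermsymmx /\
  forall v : 'rV[R[i]]_n, 0 <= (v *m A *m v ^t*) 0 0.

Definition herm_pd (A : 'M[R[i]]_n) : Prop :=
  A \is hermsymmx /\
  forall v : 'rV[R[i]]_n, v != 0 -> 0 < (v *m A *m v ^t*) 0 0.

Definition supported_in U (chi : Cn R n -> R) : Prop :=
  exists K : set (Cn R n),
    [/\ compact K, K `<=` U & forall z, ~ K z -> chi z = 0].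

(* Lebesgue integration over R^m and C^n, as iterated integrals; only applied
   to continuous functions with compact support. *)
Fixpoint rV_int (m : nat) : ('rV[R]_m -> R) -> R :=
  match m with
  | 0%N => fun f => f 0
  | m'.+1 => fun f =>
      Rintegral (@lebesgue_measure R) setT
        (fun t : R => @rV_int m' (fun v => f (row_mx (t%:M : 'rV_1) v)))
  end.

Definition Cn_int (f : Cn R n -> R) : R :=
  rV_int (fun x : 'rV[R]_n => rV_int (fun y : 'rV[R]_n => f (x, y))).

End Calculus.

Record complex_atlas (R : realType) (n : nat) (M : ptopologicalType) := {
  chart : Type;
  dom : chart -> set M;
  cod : chart -> set (Cn R n);
  coord : chart -> M -> Cn R n;
  param : chart -> Cn R n -> M;
  dom_open : forall i, open (dom i);
  cod_open : forall i, open (cod i);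
  dom_cover : forall x, exists i, dom i x;
  coord_cod : forall i x, dom i x -> cod i (coord i x);
  param_dom : forall i z, cod i z -> dom i (param i z);
  coordK : forall i x, dom i x -> param i (coord i x) = x;
  paramK : forall i z, cod i z -> coord i (param i z) = z;
  coord_continuous : forall i x, dom i x -> {for x, continuous (coord i)};
  param_continuous : forall i z, cod i z -> {for z, continuous (param i)};
  transition_holomorphic : forall i j (c : 'I_n),
    holomorphic_on [set z | cod i z /\ dom j (param i z)]
                   (fun z => coordC (coord j (param i z)) c) }.

Section Manifold.
Context {R : realType} {n : nat} {M : ptopologicalType}.
Variable A : complex_atlas R n M.
Notation chart := (chart A).
Notation cod := (@cod R n M A).
Notation dom := (@dom R n M A).
Notation coord := (@coord R n M A).
Notation param := (@param R n M A).
Notation C := R[i].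

Definition overlap (i j : chart) : set (Cn R n) :=
  [set z | cod i z /\ dom j (param i z)].
Definition transition (i j : chart) (z : Cn R n) : Cn R n := coord j (param i z).

Definition jac (i j : chart) (z : Cn R n) : 'M[C]_n :=
  \matrix_(c, a) dz a (fun w => coordC (transition i j w) c) z.

(* A (1,1)-form is the family of its matrices in the charts; the values of
   such a family at i outside cod i are irrelevant. *)
Definition form11 := chart -> Cn R n -> 'M[C]_n.

Definition real_form11 (G : form11) : Prop :=
  [/\ forall i a b, csmooth_on (cod i) (fun z => G i z a b),
      forall i z, cod i z -> G i z \is hermsymmx &
      forall i j z, overlap i j z ->
        G i z = (jac i j z)^T *m G j (transition i j z) *m
                map_mx Num.conj (jac i j z)].

(* d G = 0; as G is real, the (1,2)-part of d G is conjugate to the (2,1)-part *)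
Definition closed_form11 (G : form11) : Prop :=
  forall i z (a b c : 'I_n), cod i z ->
    dz a (fun w => G i w b c) z = dz b (fun w => G i w a c) z.

Definition Kahler_metric (G : form11) : Prop :=
  [/\ real_form11 G, closed_form11 G & forall i z, cod i z -> herm_pd (G i z)].

(* G = d xi for the real 1-form xi = sum_a eta_a dz_a + conj(eta_a dz_a) *)
Definition exact_form11 (G : form11) : Prop :=
  exists eta : chart -> Cn R n -> 'rV[C]_n,
  [/\ forall i a, csmooth_on (cod i) (fun z => eta i z 0 a),
      forall i j z, overlap i j z ->
        eta i z = eta j (transition i j z) *m jac i j z,
      forall i z (a b : 'I_n), cod i z ->
        dz a (fun w => eta i w 0 b) z = dz b (fun w => eta i w 0 a) z &
      forall i z (a b : 'I_n), cod i z ->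
        'i * G i z a b = dz a (fun w => (eta i w 0 b)^*) z
                         - dzbar b (fun w => eta i w 0 a) z].

Definition Ric_form (G : form11) : form11 := fun i => Ric (G i).

(* c_1(M) is normalized as the de Rham class of Ric(omega), without 2 pi. *)
Definition in_c1 (G : form11) : Prop :=
  exists2 omega, Kahler_metric omega &
    exact_form11 (fun i z => G i z - Ric_form omega i z).

Definition Fano : Prop :=
  [/\ compact [set: M], hausdorff_space M, connected [set: M] &
      exists2 omega, Kahler_metric omega & in_c1 omega].

(* Holomorphic section of - p K_M; sigma i is the coefficient of the p-th power
   of the local frame d/dz_1 /\ ... /\ d/dz_n. *)
Definition plurianticanonical_section (p : nat)
    (sigma : chart -> Cn R n -> C) : Prop :=
  (forall i, holomorphic_on (cod i) (sigma i)) /\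
  (forall i j z, overlap i j z ->
     sigma j (transition i j z) = \det (jac i j z) ^+ p * sigma i z).

(* div sigma = q D with D a smooth (reduced) hypersurface: locally
   sigma = u f^q with u a unit, D = (f = 0) and df <> 0 on D. *)
Definition divisor_is_multiple_of_smooth (q : nat)
    (sigma : chart -> Cn R n -> C) (D : set M) : Prop :=
  forall i z, cod i z -> exists (U : set (Cn R n)) (u f : Cn R n -> C),
    [/\ open U /\ U z, U `<=` cod i,
        holomorphic_on U u /\ holomorphic_on U f,
        forall w, U w -> u w != 0 /\ sigma i w = u w * f w ^+ q &
        forall w, U w -> (D (param i w) <-> f w = 0) /\
                         (f w = 0 -> exists a, dz a f w != 0)].

(* Smooth divisor D in |- (p / q) K_M|, that is q D in |- p K_M|: sigma is s^q
   for the defining section s of D. *)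
Definition smooth_divisor_in (p q : nat) (sigma : chart -> Cn R n -> C)
    (D : set M) : Prop :=
  plurianticanonical_section p sigma /\ divisor_is_multiple_of_smooth q sigma D.

(* Smooth Hermitian metric on - lambda K_M; h i is the squared norm of the
   lambda-th power of the local frame d/dz_1 /\ ... /\ d/dz_n. *)
Definition hermitian_metric (lambda : R) (h : chart -> Cn R n -> R) : Prop :=
  [/\ forall i, smooth_on (cod i) (h i),
      forall i z, cod i z -> 0 < h i z &
      forall i j z, overlap i j z ->
        h i z = sqmod (\det (jac i j z)) `^ lambda * h j (transition i j z)].

Definition curvature (h : chart -> Cn R n -> R) : form11 :=
  fun i z => - ddbar (fun w => ln (h i w)) z.

(* |s|_h^2 where sigma = s^q *)
Definition sqnorm (q : nat) (sigma : chart -> Cn R n -> C)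
    (h : chart -> Cn R n -> R) (i : chart) (z : Cn R n) : R :=
  sqmod (sigma i z) `^ (q%:R^-1) * h i z.

Definition theta (lambda : R) (omega0 : form11) (S : chart -> Cn R n -> R)
    (eps : R) : form11 :=
  fun i z => lambda%:C *: omega0 i z + ddbar (fun w => ln (eps ^+ 2 + S i w)) z.

(* omega0 + sqrt(-1) ddbar u *)
Definition deform (omega0 : form11) (u : M -> R) : form11 :=
  fun i z => omega0 i z + ddbar (fun w => u (param i w)) z.

(* omega0 + sqrt(-1) ddbar phi0 >= 0 as a current, with continuous potential *)
Definition positive_current (omega0 : form11) (phi0 : M -> R) : Prop :=
  continuous phi0 /\
  forall i (chi : Cn R n -> R) (v : 'rV[C]_n),
    smooth_on setT chi -> supported_in (cod i) chi -> (forall z, 0 <= chi z) ->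
    0 <= Cn_int (fun z =>
           phi0 (param i z) * complex.Re ((v *m ddbar chi z *m v ^t*) 0 0)
           + chi z * complex.Re ((v *m omega0 i z *m v ^t*) 0 0)).

Definition Borel := g_sigma_algebraType (@open M).

(* The Borel measures omega0^n and (omega0 + sqrt(-1) ddbar phi0)^n, both
   divided by the same constant n! 2^n. *)
Definition volume_measure (omega0 : form11)
    (mu : {measure set Borel -> \bar R}) : Prop :=
  forall i (chi : Cn R n -> R), continuous chi -> supported_in (cod i) chi ->
    (\int[mu]_(x in dom i) (chi (coord i x))%:E
     = (Cn_int (fun z => chi z * complex.Re (\det (omega0 i z))))%:E)%E.

(* Bedford-Taylor: the Monge-Ampere measure of a continuous omega0-psh phi0 is
   the weak limit of those of smooth omega0-psh functions decreasing locally to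
   phi0. Such sequences exist near every point, so mu is determined. *)
Definition MongeAmpere_measure (omega0 : form11) (phi0 : M -> R)
    (mu : {measure set Borel -> \bar R}) : Prop :=
  forall i (V : set (Cn R n)) (u : nat -> Cn R n -> R),
    open V -> V `<=` cod i ->
    (forall k, smooth_on V (u k)) ->
    (forall k z, V z -> herm_psd (omega0 i z + ddbar (u k) z)) ->
    (forall k z, V z -> u k.+1 z <= u k z) ->
    (forall z, V z -> u k z @[k --> \oo] --> phi0 (param i z)) ->
  forall chi : Cn R n -> R, continuous chi -> supported_in V chi ->
    (Cn_int (fun z => chi z * complex.Re (\det (omega0 i z + ddbar (u k) z))))%:E
      @[k --> \oo] --> (\int[mu]_(x in dom i) (chi (coord i x))%:E)%E.

Definition Lp_density_full_mass (omega0 : form11) (phi0 : M -> R) (r : R)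
    : Prop :=
  exists mu0 mu : {measure set Borel -> \bar R},
  [/\ volume_measure omega0 mu0, MongeAmpere_measure omega0 phi0 mu,
      mu setT = mu0 setT &
      exists f : Borel -> R,
        [/\ measurable_fun setT f, forall x, 0 <= f x,
            (\int[mu0]_x (f x `^ r)%:E < +oo)%E &
            forall B, measurable B -> mu B = (\int[mu0]_(x in B) (f x)%:E)%E]].

(* omega0 + sqrt(-1) ddbar phi(t) solves
     d omega / dt = - Ric(omega) + mu omega + (1 - gamma) th
   with initial value omega0 + sqrt(-1) ddbar phi0. *)
Definition twisted_KRF_solution (omega0 : form11) (mu gamma : R) (th : form11)
    (phi0 : M -> R) (phi : R -> M -> R) : Prop :=
  [/\ {within [set tx : R * M | 0 <= tx.1], continuous (fun tx => phi tx.1 tx.2)},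
      forall i, smooth_on [set tz : R^o * Cn R n | 0 < tz.1 /\ cod i tz.2]
                          (fun tz => phi tz.1 (param i tz.2)),
      forall t, 0 < t -> Kahler_metric (deform omega0 (phi t)),
      forall t i z (a b : 'I_n), 0 < t -> cod i z ->
        cderive (1 : R^o) (fun s : R^o => deform omega0 (phi s) i z a b) t
        = (- Ric_form (deform omega0 (phi t)) i z
           + mu%:C *: deform omega0 (phi t) i z
           + (1 - gamma)%:C *: th i z) a b &
      phi 0 = phi0 /\
      forall e : R, 0 < e -> \forall t \near 0^'+, forall x,
        `|phi t x - phi0 x| <= e].

End Manifold.

(* Main.v *)
Require Import Defs.
From mathcomp Require Import all_boot all_order all_algebra complex.
From mathcomp Require Import perm sesquilinear spectral ring lra.
From mathcomp Require Import all_classical all_reals all_analysis.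
Set Implicit Arguments.
Unset Strict Implicit.
Unset Printing Implicit Defensive.
Import Order.TTheory GRing.Theory Num.Theory.
Import numFieldNormedType.Exports.
Local Open Scope classical_set_scope.
Local Open Scope ring_scope.
Local Open Scope complex_scope.
Local Open Scope sesquilinear_scope.

(** Write g for the evolving metric, F = Ric - (1 - gamma) theta, and S = tr_g F
    for the function to be bounded below. The flow says dg/dt = mu g - F.

    Jacobi's formula gives w := d/dt log det g = tr_g (dg/dt) = n mu - S, so a
    lower bound for S is an upper bound for w. As Ric = - sqrt(-1) ddbar log det g
    and theta is constant in time, differentiating the flow equation gives
      d^2 g / dt^2 = sqrt(-1) ddbar w + mu dg/dt ,
    and therefore
      dw/dt = Delta w + mu w - |dg/dt|_g^2 <= Delta w + mu w - w^2 / n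
    by the Cauchy-Schwarz inequality (log_det_flow_ineq). This is a differential
    inequality of Riccati type, which forces w down to n mu + n / (t - a) at time
    t whatever its values at time a: at a positive maximum of
    (t - a) (w - n mu) on [a, b] x M, attained after time a, one has
    Delta w <= 0 and d/dt ((t - a) (w - n mu)) >= 0, and the two inequalities
    together bound the maximum by n (growth_bound). The choice a = 1/2 gives
    S >= - n / (t - 1/2) >= - 2 n for t >= 1.

    The function w lives on M because g and dg/dt are pulled back by the same
    Jacobian matrix under a change of chart (volume_growth_transition), and the
    maximum exists because M is compact. All derivatives are directional
    derivatives of real functions, of which four facts are used: additivity in
    the direction (derive_dirD), symmetry of second derivatives (derive_comm),
    the second derivative test (derive2_at_max), and stability of smoothness
    under the operations that build log det g out of the potential. *)

(** * Directional derivatives *)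

Section DirectionalDerivatives.
Context {R : realType} {V : normedModType R}.
Implicit Types (f g : V -> R) (x u v : V) (U : set V).

Lemma is_derive_line f x v (s : R) : derivable f (s *: v + x) v ->
  is_derive s (1 : R) (fun r : R => f (r *: v + x)) ('D_v f (s *: v + x)).
Proof.
move=> df.
have E : (fun h : R => h^-1 *: (((fun r : R => f (r *: v + x)) \o shift s) (h *: (1 : R))
    - f (s *: v + x))) =
  (fun h => h^-1 *: ((f \o shift (s *: v + x)) (h *: v) - f (s *: v + x))).
  apply/funext => h /=; rewrite [h *: 1]mulr1 scalerDl addrA //.
by split; rewrite /derivable /derive E.
Qed.

Lemma is_derive_scale f x v (a : R) (d : R) :
  is_derive x v f d -> is_derive x (a *: v) f (a * d).
Proof.
move=> [df <-].
have d0 : derivable f (0 *: v + x) v by rewrite scale0r add0r.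
have H := is_derive_line d0.
have H2 : is_derive (0 : R) (1 : R) (fun r : R => f (r *: v + x) : R) ('D_v f x).
  by move: H; rewrite scale0r add0r.
have H3 : is_derive (0 : R) (1 : R) (fun r : R => a * r : R) a.
  have := @is_deriveZ R R R id a 0 1 1 (is_derive_id (0 : R) (1 : R)).
  by rewrite [_ *: 1]mulr1.
have H4 := @is_derive1_comp R (fun r : R => f (r *: v + x)) (fun r => a * r) 0 _ _
  (_ : is_derive (a * 0) 1 _ ('D_v f x)) H3.
have {H4} [H4 H5] : is_derive (0:R) (1:R) (fun r : R => f (r *: (a *: v) + x)) (a * 'D_v f x).
  rewrite mulrC; under eq_fun do rewrite scalerA (mulrC _ a).
  by apply: H4; rewrite mulr0.
have D := (derivable1P f x (a *: v)).2 H4; split => //.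
rewrite -H5; apply/esym.
have d1 : derivable f (0 *: (a *: v) + x) (a *: v) by rewrite scale0r add0r.
by have [_ ->] := is_derive_line d1; rewrite scale0r add0r.
Qed.

(** The strict inequality 0 < c is what the second derivative test needs. *)
Lemma MVT_line f x v : (forall s : R, 0 <= s <= 1 -> derivable f (s *: v + x) v) ->
  exists2 c : R, 0 < c < 1 & f (v + x) - f x = 'D_v f (c *: v + x).
Proof.
move=> df.
have [|| c] := @MVT R (fun r => f (r *: v + x))
   (fun r => 'D_v f (r *: v + x)) 0 1 ltr01.
- by move=> s /itvP h; apply: is_derive_line; apply: df; rewrite !h.
- apply: derivable_within_continuous => s; rewrite in_itv /= => s01.
  by have [] := is_derive_line (df _ s01).
rewrite in_itv /= => c01; rewrite subr0 mulr1 scale1r scale0r add0r => E.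
by exists c.
Qed.

Lemma is_derive_shiftl f w x v (d : R) :
  is_derive (w + x) v f d -> is_derive x v (fun y => f (w + y)) d.
Proof.
move=> [df <-].
have E : (fun h : R => h^-1 *: (((fun y => f (w + y)) \o shift x) (h *: v) - f (w + x))) =
   (fun h => h^-1 *: ((f \o shift (w + x)) (h *: v) - f (w + x))).
  by apply/funext => h /=; rewrite addrCA.
by split; rewrite /derivable /derive E.
Qed.

(** The form in which the proofs below that move in two directions at once use
    continuity of (a, b) |-> x + a u + b v at the origin. *)
Lemma near_plane (P : V -> Prop) x u v : (\forall y \near x, P y) ->
  exists2 d : R, 0 < d &
    forall a b : R, `|a| <= d -> `|b| <= d -> P (a *: u + (b *: v + x)).
Proof.
move=> /nbhs_ballP[e /= e0 He].
have k0 : 0 < `|u| + `|v| + 1 by rewrite ltr_pwDr// addr_ge0.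
exists (e / (`|u| + `|v| + 1)); first exact: divr_gt0.
move=> a b ad bd; apply: He; rewrite -ball_normE /=.
rewrite addrA opprD addrCA subrr addr0 normrN.
rewrite (le_lt_trans (ler_normD _ _))// !normrZ.
have du := ler_wpM2r (normr_ge0 u) ad.
have dv := ler_wpM2r (normr_ge0 v) bd.
rewrite (le_lt_trans (lerD du dv))// -mulrDr.
rewrite mulrAC ltr_pdivrMr// ltr_pM2l// ltrDl ltr01//.
Qed.

(** The increment along h (u + v) is the increment along h v followed by one along
    h u from the displaced point. By the mean value theorem the latter is h times
    D_u f at a point that tends to x with h. *)
Lemma derive_dirD f x u v :
  (\forall y \near x, derivable f y u) -> {for x, continuous ('D_u f)} ->
  derivable f x v -> derivable f x (u + v) ->
  'D_(u + v) f x = 'D_u f x + 'D_v f x.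
Proof.
move=> dfu cfu dfv dfuv.
apply: cvg_lim => //.
rewrite (_ : (fun h => _) = (fun h : R => h^-1 *: (f (h *: u + (h *: v + x)) - f (h *: v + x))
   + h^-1 *: (f (h *: v + x) - f x))); last first.
  by apply/funext => h /=; rewrite -scalerDr addrA subrK [h *: (u + v)]scalerDr addrA.
apply: cvgD; last exact: dfv.
apply/cvgrPdist_le => e e0.
have /(near_plane u v)[d d0 Hd] : \forall y \near x,
    derivable f y u /\ `|'D_u f x - 'D_u f y| <= e.
  near=> y; split; first by near: y.
  near: y; move/cvgrPdist_le : cfu; exact.
near=> h.
have h0 : h != 0 by near: h; exact: nbhs_dnbhs_neq.
have hd : `|h| <= d.
  near: h; apply: nbhs_dnbhs; apply/nbhs_ballP; exists d => //= y.
  by rewrite -ball_normE /= sub0r normrN => /ltW.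
have sd (s : R) : 0 <= s <= 1 -> `|s * h| <= d.
  move=> /andP[s0 s1]; rewrite normrM ger0_norm//.
  by rewrite (le_trans _ hd)// ler_piMl.
have [s s01|c /andP[/ltW c0 /ltW c1]] := @MVT_line f (h *: v + x) (h *: u).
  rewrite scalerA; have [df _] := Hd _ _ (sd _ s01) hd.
  by have [] := is_derive_scale h (derivableP df).
rewrite scalerA => ->.
have c01 : 0 <= c <= 1 by rewrite c0.
have [df ec] := Hd _ _ (sd _ c01) hd.
have [_ ->] := is_derive_scale h (derivableP df).
by rewrite [_ *: _]mulKf.
Unshelve. all: by end_near. Qed.

(** Mean value theorem twice: for y |-> f (d v + y) - f y in the direction u, then
    for D_u f in the direction v. *)
Lemma second_difference f x u v (d : R) : 0 < d ->
  (forall a b : R, `|a| <= d -> `|b| <= d ->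
     derivable f (a *: u + (b *: v + x)) u /\
     derivable ('D_u f) (a *: u + (b *: v + x)) v) ->
  exists a b : R, [/\ `|a| <= d, `|b| <= d &
  f (d *: u + (d *: v + x)) - f (d *: v + x) - (f (d *: u + x) - f x)
  = d * (d * 'D_v ('D_u f) (a *: u + (b *: v + x)))].
Proof.
move=> d0 Hd.
have sd (s : R) : 0 <= s <= 1 -> `|s * d| <= d.
  by move=> /andP[s0 s1]; rewrite normrM !ger0_norm// ?ler_piMl// ltW.
have dd : `|d| <= d by rewrite gtr0_norm.
have zd : `|0 : R| <= d by rewrite normr0 ltW.
pose g y := f (d *: v + y) - f y.
have dg (a : R) : `|a| <= d -> is_derive (a *: u + x) (d *: u) g
    (d * 'D_u f (d *: v + (a *: u + x)) - d * 'D_u f (a *: u + x)).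
  move=> ad; apply: is_deriveB.
    apply: is_derive_shiftl; apply: is_derive_scale; apply: derivableP.
    by rewrite addrCA; have [] := Hd _ _ ad dd.
  apply: is_derive_scale; apply: derivableP.
  by have [] := Hd _ _ ad zd; rewrite scale0r add0r.
have [s s01|c /andP[/ltW c0 /ltW c1]] := @MVT_line g x (d *: u).
  by rewrite scalerA; have [] := dg _ (sd _ s01).
have c01 : 0 <= c <= 1 by rewrite c0.
rewrite scalerA; have [_ ->] := dg _ (sd _ c01).
have [s s01|c' /andP[/ltW c0' /ltW c1']] := @MVT_line ('D_u f) ((c * d) *: u + x) (d *: v).
  rewrite scalerA addrCA; have [_ df] := Hd _ _ (sd _ c01) (sd _ s01).
  by have [] := is_derive_scale d (derivableP df).
have c01' : 0 <= c' <= 1 by rewrite c0'.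
rewrite scalerA [X in 'D_(d *: v) _ X]addrCA.
have [_ df] := Hd _ _ (sd _ c01) (sd _ c01').
have [_ ->] := is_derive_scale d (derivableP df).
move=> E1 E2; exists (c * d), (c' * d); split; [exact: sd|exact: sd|].
by rewrite -E1 mulrBr -E2 /g [d *: v + (d *: u + x)]addrCA; ring.
Qed.

(** The second difference is symmetric in u and v, so a value of D_v D_u f and a
    value of D_u D_v f, both taken arbitrarily close to x, coincide. *)
Lemma derive_comm f x u v :
  (\forall y \near x, [/\ derivable f y u, derivable f y v,
     derivable ('D_u f) y v & derivable ('D_v f) y u]) ->
  {for x, continuous ('D_v ('D_u f))} -> {for x, continuous ('D_u ('D_v f))} ->
  'D_v ('D_u f) x = 'D_u ('D_v f) x.
Proof.
move=> df cuv cvu; apply/eqP; rewrite -subr_eq0 -normr_le0.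
apply/ler_addgt0Pr => e e0; rewrite add0r.
have e20 : 0 < e / 2 by rewrite divr_gt0.
have N : \forall y \near x, [/\ derivable f y u, derivable f y v,
     derivable ('D_u f) y v & derivable ('D_v f) y u] /\
   `|'D_v ('D_u f) x - 'D_v ('D_u f) y| <= e / 2 /\
   `|'D_u ('D_v f) x - 'D_u ('D_v f) y| <= e / 2.
  have /cvgrPdist_le/(_ _ e20) c1 := cuv; have /cvgrPdist_le/(_ _ e20) c2 := cvu.
  exact (filterS3 _ (fun y h1 h2 h3 => conj h1 (conj h2 h3)) df c1 c2).
have [d1 d10 H1] := near_plane u v N.
have [d2 d20 H2] := near_plane v u N.
pose d := Num.min d1 d2.
have d0 : 0 < d by rewrite lt_min d10.
have dd1 (a : R) : `|a| <= d -> `|a| <= d1.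
  by move=> /le_trans; apply; rewrite ge_min lexx.
have dd2 (a : R) : `|a| <= d -> `|a| <= d2.
  by move=> /le_trans; apply; rewrite ge_min lexx orbT.
have [a b ad bd|a [b [ad bd E1]]] := @second_difference f x u v _ d0.
  by have [[]] := H1 _ _ (dd1 _ ad) (dd1 _ bd).
have [a' b' ad' bd'|a' [b' [ad' bd' E2]]] := @second_difference f x v u _ d0.
  by have [[]] := H2 _ _ (dd2 _ ad') (dd2 _ bd').
have [_ [e1 _]] := H1 _ _ (dd1 _ ad) (dd1 _ bd).
have [_ [_ e2]] := H2 _ _ (dd2 _ ad') (dd2 _ bd').
have E : 'D_v ('D_u f) (a *: u + (b *: v + x)) = 'D_u ('D_v f) (a' *: v + (b' *: u + x)).
  apply: (mulfI (lt0r_neq0 d0)); apply: (mulfI (lt0r_neq0 d0)).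
  refine (etrans (esym E1) (etrans _ E2)).
  rewrite [d *: v + (d *: u + x)]addrCA.
  ring.
move: e1 e2; rewrite E.
move: ('D_v ('D_u f) x) ('D_u ('D_v f) x) ('D_u ('D_v f) _) => A B C e1 e2.
rewrite (_ : A - B = (A - C) - (B - C)); last by ring.
apply: le_trans (ler_normB _ _) _; rewrite [e in leRHS]splitr; exact: lerD.
Qed.

(** D_v f vanishes at x. Were its derivative positive, D_v f would be positive at
    x + c h v for all small h > 0 and 0 < c < 1, and f would increase from x to
    x + h v. *)
Lemma derive2_at_max f x v : (\forall y \near x, derivable f y v) ->
  derivable ('D_v f) x v -> (\forall y \near x, f y <= f x) ->
  'D_v ('D_v f) x <= 0.
Proof.
move=> df ddf fmax; rewrite leNgt; apply/negP => D2.
have : \forall y \near x, derivable f y v /\ f y <= f x by near do split.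
move=> /(near_plane 0 v)[d d0 Hd'].
have {Hd'}Hd (r : R) : `|r| <= d -> derivable f (r *: v + x) v /\ f (r *: v + x) <= f x.
  by move=> rd; have := Hd' 0 r; rewrite normr0 scale0r add0r; apply => //; exact: ltW.
have Df0 : 'D_v f x = 0.
  have [|r| |r|_] := @derive1_at_max R (fun r => f (r *: v + x)) (- d) d 0.
  - by rewrite (@le_trans _ _ 0) ?oppr_le0 ?ltW.
  - rewrite in_itv /= => /andP[r1 r2].
    have [|df1 _] := Hd r; first by rewrite ler_norml !ltW.
    by have [] := is_derive_line df1.
  - by rewrite in_itv /= oppr_lt0 d0.
  - rewrite in_itv /= => /andP[r1 r2].
    have [|_] := Hd r; first by rewrite ler_norml !ltW.
    by rewrite scale0r add0r.
  have d00 : derivable f (0 *: v + x) v.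
    by have [|df0 _] := Hd 0; [rewrite normr0 ltW|exact: df0].
  by have [_ ->] := is_derive_line d00; rewrite scale0r add0r.
have : \forall h \near (0 : R)^', 0 < h^-1 *: ('D_v f (h *: v + x) - 'D_v f x).
  by move/cvgr_gt : ddf; exact.
move=> /nbhs_ballP[e /= e0 He].
pose h := Num.min d (e / 2).
have h0 : 0 < h by rewrite lt_min d0 divr_gt0.
have hd : h <= d by rewrite ge_min lexx.
have he : h < e.
  by rewrite gt_min; apply/orP; right; rewrite ltr_pdivrMr// ltr_pMr// ltr1n.
have [s /andP[s0 s1]|c /andP[c0 c1]] := @MVT_line f x (h *: v).
  rewrite scalerA; have [|df1 _] := Hd (s * h).
    by rewrite ger0_norm ?(le_trans _ hd) ?mulr_ge0 ?ler_piMl// ltW.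
  by have [] := is_derive_scale h (derivableP df1).
have ch0 : 0 < c * h by rewrite mulr_gt0.
have chh : c * h < h by rewrite gtr_pMl.
rewrite scalerA; have [|df1 _] := Hd (c * h).
  by rewrite gtr0_norm// ltW// (lt_le_trans chh).
have [_ ->] := is_derive_scale h (derivableP df1).
have := He (c * h); rewrite -ball_normE /= sub0r normrN gtr0_norm//.
rewrite Df0 subr0 (lt_trans chh he) => /(_ isT); rewrite gt_eqF// => /(_ isT).
rewrite -[_ *: _]/(_ * _) pmulr_rgt0 ?invr_gt0// => D0 E.
have [|_] := Hd h; first by rewrite gtr0_norm.
by rewrite -subr_le0 E leNgt mulr_gt0.
Unshelve. all: by end_near. Qed.

End DirectionalDerivatives.

(** The difference quotients at b with negative increments are nonnegative, and
    their limit is the two-sided derivative. *)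
Lemma derive_at_right_end_max {R : realType} (g : R -> R) (a b : R) : a < b ->
  derivable g b 1 -> (forall s, a <= s <= b -> g s <= g b) -> 0 <= 'D_1 g b.
Proof.
move=> ab dg gmax; rewrite leNgt; apply/negP => D0.
have : \forall h \near (0 : R)^', h^-1 *: (g (h *: 1 + b) - g b) < 0.
  by move/cvgr_lt : dg; exact.
move=> /nbhs_ballP[e /= e0 He].
pose h := Num.min (b - a) (e / 2).
have h0 : 0 < h by rewrite lt_min subr_gt0 ab divr_gt0.
have hd : h <= b - a by rewrite ge_min lexx.
have he : h < e.
  by rewrite gt_min; apply/orP; right; rewrite ltr_pdivrMr// ltr_pMr// ltr1n.
have := He (- h); rewrite -ball_normE /= sub0r opprK gtr0_norm// he => /(_ isT).
rewrite oppr_eq0 gt_eqF// => /(_ isT).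
rewrite [_ *: 1]mulr1 -[_ *: _]/(_ * _) nmulr_rlt0 ?invr_lt0 ?oppr_lt0// subr_gt0 ltNge.
by rewrite gmax// addrC -lerBrDl; apply/andP; split; lra.
Qed.

(** * Smooth functions on an open set *)

Section SmoothFunctions.
Context {R : realType} {V : normedModType R}.
Implicit Types (f g : V -> R) (x u v : V) (U : set V).

Lemma is_derive_lineP f x v (d : R) : is_derive x v f d <->
  is_derive (0 : R) (1 : R) (fun r : R => f (r *: v + x)) d.
Proof.
have E : (fun h : R => h^-1 *: (((fun r : R => f (r *: v + x)) \o shift 0) (h *: (1 : R))
    - f (0 *: v + x))) =
  (fun h => h^-1 *: ((f \o shift x) (h *: v) - f x)).
  by apply/funext => h /=; rewrite addr0 [h *: 1]mulr1 scale0r add0r.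
by split=> -[df Df]; split; move: df Df; rewrite /derivable /derive ?E//.
Qed.

Lemma is_derive_chain (g : R -> R) f x v (d e : R) :
  is_derive x v f d -> is_derive (f x) 1 g e -> is_derive x v (g \o f) (e * d).
Proof.
move=> /is_derive_lineP df dg; apply/is_derive_lineP.
apply: (@is_derive1_comp R g (fun r : R => f (r *: v + x))) => //.
by rewrite scale0r add0r.
Qed.

Lemma near_eq_for_continuous f g x :
  (\forall y \near x, f y = g y) -> {for x, continuous f} -> {for x, continuous g}.
Proof.
move=> fg; rewrite /prop_for /continuous_at (nbhs_singleton fg) => cf.
apply: cvg_trans cf; apply: near_eq_cvg.
exact: fg.
Qed.

Lemma open_near U x (P : V -> Prop) : open U -> U x ->
  (forall y, U y -> P y) -> \forall y \near x, P y.
Proof.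
move=> oU Ux H; near=> y; apply: H; near: y; exact: open_nbhs_nbhs.
Unshelve. all: by end_near. Qed.

Lemma Ck_continuous k U f x : Ck k U f -> U x -> {for x, continuous f}.
Proof. by case: k => [|k] [cf _]; exact: cf. Qed.

Lemma CkW k U f : Ck k.+1 U f -> Ck k U f.
Proof.
elim: k f => [|k IH] f [cf df]; split => // v.
by have [dfv /IH] := df v.
Qed.

Lemma Ck_ext k U f g : open U -> (forall x, U x -> f x = g x) ->
  Ck k U f -> Ck k U g.
Proof.
move=> oU; elim: k f g => [|k IH] f g fg [cf df]; (split; last first) => //.
- by move=> x Ux; apply: near_eq_for_continuous (cf _ Ux); exact: open_near fg.
- move=> v; have [dfv ck] := df v; split.
    by move=> x Ux; apply: near_eq_derivable (dfv _ Ux); exact: open_near fg.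
  apply: IH ck => x Ux; apply: near_eq_derive.
  exact: open_near fg.
- by move=> x Ux; apply: near_eq_for_continuous (cf _ Ux); exact: open_near fg.
Qed.

Lemma Ck_cst k U (c : R) : Ck k U (fun=> c).
Proof.
elim: k c => [|k IH] c; split => //; try by move=> x _; exact: cvg_cst.
move=> v; split; first by move=> x _; exact: derivable_cst.
have -> : (fun x => 'D_v (fun=> c : R) x) = fun=> 0 by apply/funext => x; exact: derive_cst.
exact: IH.
Qed.

Lemma CkD k U f g : open U -> Ck k U f -> Ck k U g -> Ck k U (fun x => f x + g x).
Proof.
move=> oU; elim: k f g => [|k IH] f g [cf df] [cg dg]; (split; last first) => //.
- by move=> x Ux; apply: cvgD; [exact: cf|exact: cg].
- move=> v; have [dfv ckf] := df v; have [dgv ckg] := dg v; split.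
    by move=> x Ux; apply: derivableD; [exact: dfv|exact: dgv].
  apply: Ck_ext (IH _ _ ckf ckg) => // x Ux.
  by rewrite -deriveD//; [exact: dfv|exact: dgv].
- by move=> x Ux; apply: cvgD; [exact: cf|exact: cg].
Qed.

Lemma CkM k U f g : open U -> Ck k U f -> Ck k U g -> Ck k U (fun x => f x * g x).
Proof.
move=> oU; elim: k f g => [|k IH] f g Cf Cg; have [cf df] := Cf;
  have [cg dg] := Cg; (split; last first) => //.
- by move=> x Ux; apply: cvgM; [exact: cf|exact: cg].
- move=> v; have [dfv ckf] := df v; have [dgv ckg] := dg v; split.
    by move=> x Ux; apply: derivableM; [exact: dfv|exact: dgv].
  have H := CkD oU (IH _ _ (CkW Cf) ckg) (IH _ _ (CkW Cg) ckf).
  apply: Ck_ext H => // x Ux.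
  by rewrite -[LHS]deriveM//; [exact: dfv|exact: dgv].
- by move=> x Ux; apply: cvgM; [exact: cf|exact: cg].
Qed.

Lemma CkN k U f : open U -> Ck k U f -> Ck k U (fun x => - f x).
Proof.
move=> oU Cf; have := CkM oU (@Ck_cst k U (-1)) Cf.
by apply: Ck_ext => // x _; rewrite mulN1r.
Qed.

Lemma CkV k U f : open U -> (forall x, U x -> f x != 0) -> Ck k U f ->
  Ck k U (fun x => (f x)^-1).
Proof.
move=> oU f0; elim: k f f0 => [|k IH] f f0 Cf; have [cf df] := Cf; (split; last first) => //.
- by move=> x Ux; apply: cvgV; [exact: f0|exact: cf].
- move=> v; have [dfv ckf] := df v; split.
    by move=> x Ux; apply: derivableV; [exact: f0|exact: dfv].
  have CV := IH _ f0 (CkW Cf).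
  have H := CkN oU (CkM oU (CkM oU CV CV) ckf).
  apply: Ck_ext H => // x Ux.
  rewrite deriveV ?f0//; last exact: dfv.
  by rewrite -invfM -expr2 -mulNr.
- by move=> x Ux; apply: cvgV; [exact: f0|exact: cf].
Qed.

Lemma Ck_ln k U f : open U -> (forall x, U x -> 0 < f x) -> Ck k U f ->
  Ck k U (fun x => ln (f x)).
Proof.
move=> oU f0 Cf.
have cl x : U x -> {for x, continuous (fun x => ln (f x))}.
  move=> Ux; apply: (@continuous_comp _ _ _ f (@ln R)).
    exact: Ck_continuous Cf Ux.
  exact/continuous_ln/f0.
case: k Cf => [|k] Cf; split => // v.
have [cf df] := Cf; have [dfv ckf] := df v.
have dl x : U x -> is_derive x v (fun x => ln (f x)) ((f x)^-1 * 'D_v f x).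
  move=> Ux; apply: is_derive_chain; first exact/derivableP/dfv.
  by apply: is_derive1_ln; exact: f0.
split; first by move=> x /dl[].
have f00 x : U x -> f x != 0 by move=> /f0; exact: lt0r_neq0.
apply: Ck_ext (CkM oU (CkV oU f00 (CkW Cf)) ckf) => // x Ux.
by have [_ ->] := dl _ Ux.
Qed.

Lemma smooth_derivable U f x v : smooth_on U f -> U x -> derivable f x v.
Proof. by move=> /(_ 1%N)[_ /(_ v)[df _]]; exact: df. Qed.

Lemma smooth_derive U f v : smooth_on U f -> smooth_on U ('D_v f).
Proof. by move=> sf k; have [_ /(_ v)[]] := sf k.+1. Qed.

Lemma smooth_continuous U f x : smooth_on U f -> U x -> {for x, continuous f}.
Proof. by move=> /(_ 0%N); exact: Ck_continuous. Qed.

Lemma smooth_ext U f g : open U -> (forall x, U x -> f x = g x) ->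
  smooth_on U f -> smooth_on U g.
Proof. by move=> oU fg sf k; exact: Ck_ext (sf k). Qed.

Lemma smooth_cst U (c : R) : smooth_on U (fun=> c).
Proof. by move=> k; exact: Ck_cst. Qed.

Lemma smoothD U f g : open U -> smooth_on U f -> smooth_on U g ->
  smooth_on U (fun x => f x + g x).
Proof. by move=> oU sf sg k; exact: CkD. Qed.

Lemma smoothN U f : open U -> smooth_on U f -> smooth_on U (fun x => - f x).
Proof. by move=> oU sf k; exact: CkN. Qed.

Lemma smoothM U f g : open U -> smooth_on U f -> smooth_on U g ->
  smooth_on U (fun x => f x * g x).
Proof. by move=> oU sf sg k; exact: CkM. Qed.

Lemma smoothV U f : open U -> (forall x, U x -> f x != 0) -> smooth_on U f ->
  smooth_on U (fun x => (f x)^-1).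
Proof. by move=> oU f0 sf k; exact: CkV. Qed.

Lemma smooth_ln U f : open U -> (forall x, U x -> 0 < f x) -> smooth_on U f ->
  smooth_on U (fun x => ln (f x)).
Proof. by move=> oU f0 sf k; exact: Ck_ln. Qed.

Lemma smooth_derive_comm U f x u v : open U -> smooth_on U f -> U x ->
  'D_v ('D_u f) x = 'D_u ('D_v f) x.
Proof.
move=> oU sf Ux; apply: derive_comm.
- apply: open_near oU Ux _ => y Uy; split; apply: smooth_derivable Uy => //;
  exact: smooth_derive.
- apply: smooth_continuous Ux; do 2 apply: smooth_derive; exact: sf.
- apply: smooth_continuous Ux; do 2 apply: smooth_derive; exact: sf.
Qed.

Lemma smooth_derive_linear U f x u v (a : R) : open U -> smooth_on U f -> U x ->
  'D_(a *: u + v) f x = a * 'D_u f x + 'D_v f x.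
Proof.
move=> oU sf Ux.
have du : derivable f x u by exact: smooth_derivable sf Ux.
have -> : a * 'D_u f x = 'D_(a *: u) f x.
  by have [_ ->] := is_derive_scale a (derivableP du).
apply: derive_dirD; try exact: smooth_derivable sf Ux.
- by apply: open_near oU Ux _ => y; exact: smooth_derivable.
- by apply: smooth_continuous Ux; exact: smooth_derive.
Qed.

Lemma smooth_derive_sum U f x (I : Type) (s : seq I) (c : I -> R) (e : I -> V) :
  open U -> smooth_on U f -> U x ->
  'D_(\sum_(i <- s) c i *: e i) f x = \sum_(i <- s) c i * 'D_(e i) f x.
Proof.
move=> oU sf Ux; elim: s => [|i s IH]; first by rewrite !big_nil derive0.
by rewrite !big_cons (smooth_derive_linear _ _ _ oU sf Ux) IH.
Qed.

End SmoothFunctions.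

(** * Complex-valued functions: determinants and inverse matrices *)

Section ComplexCalculus.
Context {R : realType} {V : normedModType R}.
Implicit Types (F G : V -> R[i]) (x v : V) (U : set V).
Notation Re := complex.Re.
Notation Im := complex.Im.

Lemma cReD (a b : R[i]) : Re (a + b) = Re a + Re b.
Proof. by case: a b => [? ?] [? ?]. Qed.
Lemma cImD (a b : R[i]) : Im (a + b) = Im a + Im b.
Proof. by case: a b => [? ?] [? ?]. Qed.
Lemma cReM (a b : R[i]) : Re (a * b) = Re a * Re b - Im a * Im b.
Proof. by case: a b => [? ?] [? ?]. Qed.
Lemma cImM (a b : R[i]) : Im (a * b) = Re a * Im b + Im a * Re b.
Proof. by case: a b => [? ?] [? ?]. Qed.
Lemma cReN (a : R[i]) : Re (- a) = - Re a.
Proof. by case: a. Qed.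
Lemma cImN (a : R[i]) : Im (- a) = - Im a.
Proof. by case: a. Qed.
Lemma cReV (a : R[i]) : Re a^-1 = Re a * (Re a ^+ 2 + Im a ^+ 2)^-1.
Proof. by case: a. Qed.
Lemma cImV (a : R[i]) : Im a^-1 = - (Im a * (Re a ^+ 2 + Im a ^+ 2)^-1).
Proof. by case: a. Qed.
Lemma complex_eqP (a b : R[i]) : Re a = Re b -> Im a = Im b -> a = b.
Proof. by case: a b => [? ?] [? ?] /= -> ->. Qed.

Lemma csmooth_ext U F G : open U -> (forall x, U x -> F x = G x) ->
  csmooth_on U F -> csmooth_on U G.
Proof. by move=> oU FG [r i]; split; [apply: smooth_ext r|apply: smooth_ext i] => // x /FG ->. Qed.

Lemma csmooth_cst U (c : R[i]) : csmooth_on U (fun=> c).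
Proof. by split; exact: smooth_cst. Qed.

Lemma csmoothD U F G : open U -> csmooth_on U F -> csmooth_on U G ->
  csmooth_on U (fun x => F x + G x).
Proof.
move=> oU [rF iF] [rG iG]; split.
  by apply: smooth_ext (smoothD oU rF rG) => // x _; rewrite cReD.
by apply: smooth_ext (smoothD oU iF iG) => // x _; rewrite cImD.
Qed.

Lemma csmoothM U F G : open U -> csmooth_on U F -> csmooth_on U G ->
  csmooth_on U (fun x => F x * G x).
Proof.
move=> oU [rF iF] [rG iG]; split.
  apply: smooth_ext (smoothD oU (smoothM oU rF rG) (smoothN oU (smoothM oU iF iG))) => // x _.
  by rewrite cReM.
apply: smooth_ext (smoothD oU (smoothM oU rF iG) (smoothM oU iF rG)) => // x _.
by rewrite cImM.
Qed.

Lemma csmoothV U F : open U -> (forall x, U x -> F x != 0) -> csmooth_on U F ->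
  csmooth_on U (fun x => (F x)^-1).
Proof.
move=> oU F0 [rF iF].
have sq : smooth_on U (fun x => (Re (F x) ^+ 2 + Im (F x) ^+ 2)^-1).
  apply: smoothV => //; last by apply: smoothD => //; exact: smoothM.
  move=> x /F0; case: (F x) => a b; apply: contra => /=.
  by rewrite paddr_eq0 ?sqr_ge0// !sqrf_eq0 => /andP[/eqP-> /eqP->].
split.
  by apply: smooth_ext (smoothM oU rF sq) => // x _; rewrite cReV.
by apply: smooth_ext (smoothN oU (smoothM oU iF sq)) => // x _; rewrite cImV.
Qed.

Lemma csmooth_sum U (I : Type) (s : seq I) (P : pred I) (F : I -> V -> R[i]) :
  open U -> (forall i, csmooth_on U (F i)) ->
  csmooth_on U (fun x => \sum_(i <- s | P i) F i x).
Proof.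
move=> oU sF; elim: s => [|i s IH].
  by apply: csmooth_ext (csmooth_cst U 0) => // x _; rewrite big_nil.
case Pi: (P i).
  by apply: csmooth_ext (csmoothD oU (sF i) IH) => // x _; rewrite big_cons Pi.
by apply: csmooth_ext IH => // x _; rewrite big_cons Pi.
Qed.

Lemma csmooth_prod U (I : Type) (s : seq I) (P : pred I) (F : I -> V -> R[i]) :
  open U -> (forall i, csmooth_on U (F i)) ->
  csmooth_on U (fun x => \prod_(i <- s | P i) F i x).
Proof.
move=> oU sF; elim: s => [|i s IH].
  by apply: csmooth_ext (csmooth_cst U 1) => // x _; rewrite big_nil.
case Pi: (P i).
  by apply: csmooth_ext (csmoothM oU (sF i) IH) => // x _; rewrite big_cons Pi.
by apply: csmooth_ext IH => // x _; rewrite big_cons Pi.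
Qed.

Lemma csmooth_det n U (G : V -> 'M[R[i]]_n) : open U ->
  (forall a b, csmooth_on U (fun x => G x a b)) ->
  csmooth_on U (fun x => \det (G x)).
Proof.
move=> oU sG; apply: csmooth_sum => // s; apply: csmoothM => //.
  exact: csmooth_cst.
exact: csmooth_prod.
Qed.

(** Cramer's formula. *)
Lemma csmooth_invmx n U (G : V -> 'M[R[i]]_n) : open U ->
  (forall x, U x -> G x \in unitmx) ->
  (forall a b, csmooth_on U (fun x => G x a b)) ->
  forall a b, csmooth_on U (fun x => invmx (G x) a b).
Proof.
move=> oU uG sG a b.
have detV : csmooth_on U (fun x => (\det (G x))^-1).
  by apply: csmoothV => //; exact: csmooth_det.
have sadj : csmooth_on U (fun x => \adj (G x) a b).
  have Esgn : csmooth_on U (fun x => (-1) ^+ (b + a) * \det (row' b (col' a (G x)))).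
    apply: csmoothM => //; first exact: csmooth_cst.
    apply: csmooth_det => // c d.
    by apply: csmooth_ext (sG (lift b c) (lift a d)) => // x _; rewrite !mxE.
  by apply: csmooth_ext Esgn => // x _; rewrite mxE.
apply: csmooth_ext (csmoothM oU detV sadj) => // x Ux.
by rewrite /invmx; move: (uG x Ux) => ->; rewrite [RHS]mxE.
Qed.

Definition is_cderive F x v (d : R[i]) :=
  is_derive x v (fun y => Re (F y)) (Re d) /\ is_derive x v (fun y => Im (F y)) (Im d).

Lemma csmooth_is_cderive U F x v : csmooth_on U F -> U x ->
  is_cderive F x v (cderive v F x).
Proof.
by move=> [r i] Ux; split; apply: derivableP; [exact: smooth_derivable r Ux|exact: smooth_derivable i Ux].
Qed.

Lemma is_cderive_val F x v d : is_cderive F x v d -> cderive v F x = d.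
Proof. by case: d => a b [[_ /= e1] [_ /= e2]]; rewrite /cderive e1 e2. Qed.

Lemma is_cderive_near F G x v d : (\forall y \near x, F y = G y) ->
  is_cderive F x v d -> is_cderive G x v d.
Proof.
move=> FG [r i]; split.
  by apply: near_eq_is_derive r; apply: filterS FG => y ->.
by apply: near_eq_is_derive i; apply: filterS FG => y ->.
Qed.

Lemma is_cderive_ext F G x v d : (forall y, F y = G y) ->
  is_cderive F x v d -> is_cderive G x v d.
Proof. by move=> /funext ->. Qed.

Lemma is_cderive_cst (c : R[i]) x v : is_cderive (fun=> c) x v 0.
Proof. by split; exact: is_derive_cst. Qed.

Lemma is_cderiveD F G x v d e : is_cderive F x v d -> is_cderive G x v e ->
  is_cderive (fun y => F y + G y) x v (d + e).
Proof.
move=> [r i] [r' i']; split; rewrite ?cReD ?cImD.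
  by under eq_fun do rewrite cReD; exact: is_deriveD.
by under eq_fun do rewrite cImD; exact: is_deriveD.
Qed.

Lemma is_cderiveM F G x v d e : is_cderive F x v d -> is_cderive G x v e ->
  is_cderive (fun y => F y * G y) x v (d * G x + F x * e).
Proof.
move=> [r i] [r' i']; split.
  under eq_fun do rewrite cReM.
  apply: is_derive_eq (is_deriveB (is_deriveM r r') (is_deriveM i i')) _.
  by rewrite cReD !cReM -![_ *: _]/(_ * _); ring.
under eq_fun do rewrite cImM.
apply: is_derive_eq (is_deriveD (is_deriveM r i') (is_deriveM i r')) _.
by rewrite cImD !cImM -![_ *: _]/(_ * _); ring.
Qed.

Lemma is_cderive_sum (I : Type) (s : seq I) (P : pred I) (F : I -> V -> R[i])
    (d : I -> R[i]) x v : (forall i, is_cderive (F i) x v (d i)) ->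
  is_cderive (fun y => \sum_(i <- s | P i) F i y) x v (\sum_(i <- s | P i) d i).
Proof.
move=> dF; elim: s => [|i s IH].
  rewrite big_nil; apply: is_cderive_ext (is_cderive_cst 0 x v) => y.
  by rewrite big_nil.
rewrite big_cons; case Pi: (P i).
  by apply: is_cderive_ext (is_cderiveD (dF i) IH) => y; rewrite big_cons Pi.
by apply: is_cderive_ext IH => y; rewrite big_cons Pi.
Qed.

Lemma is_cderive_prod (I : eqType) (s : seq I) (F : I -> V -> R[i])
    (d : I -> R[i]) x v : uniq s -> (forall i, is_cderive (F i) x v (d i)) ->
  is_cderive (fun y => \prod_(i <- s) F i y) x v
    (\sum_(i <- s) d i * \prod_(j <- s | j != i) F j x).
Proof.
move=> + dF; elim: s => [_|i s IH /= /andP[si us]].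
  rewrite big_nil; apply: is_cderive_ext (is_cderive_cst 1 x v) => y.
  by rewrite big_nil.
have := is_cderiveM (dF i) (IH us).
rewrite big_cons big_cons eqxx /=.
have -> : \prod_(j <- s | j != i) F j x = \prod_(j <- s) F j x.
  rewrite big_seq_cond [RHS]big_seq; apply: eq_bigl => j.
  by case: (boolP (j \in s)) => //= js; apply: contraNneq si => <-.
have -> : \sum_(k <- s) d k * \prod_(j <- i :: s | j != k) F j x
  = F i x * \sum_(k <- s) d k * \prod_(j <- s | j != k) F j x.
  rewrite mulr_sumr big_seq [RHS]big_seq; apply: eq_bigr => k ks.
  rewrite big_cons ifT; first by rewrite mulrCA.
  by apply: contraNneq si => ->.
by apply: is_cderive_ext => y; rewrite big_cons.
Qed.

Definition is_mxderive m n (G : V -> 'M[R[i]]_(m, n)) x v (B : 'M[R[i]]_(m, n)) :=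
  forall a b, is_cderive (fun y => G y a b) x v (B a b).

Definition mxderive m n (v : V) (G : V -> 'M[R[i]]_(m, n)) x : 'M[R[i]]_(m, n) :=
  \matrix_(a, b) cderive v (fun y => G y a b) x.

Lemma is_mxderive_val m n (G : V -> 'M[R[i]]_(m, n)) x v B :
  is_mxderive G x v B -> B = mxderive v G x.
Proof. by move=> dG; apply/matrixP => a b; rewrite mxE (is_cderive_val (dG a b)). Qed.

Lemma is_mxderiveM m n p (G : V -> 'M[R[i]]_(m, n)) (H : V -> 'M[R[i]]_(n, p))
    x v B C : is_mxderive G x v B -> is_mxderive H x v C ->
  is_mxderive (fun y => G y *m H y) x v (B *m H x + G x *m C).
Proof.
move=> dG dH a b; rewrite mxE mxE [X in _ + X]mxE -big_split /=.
have := is_cderive_sum (index_enum 'I_n) xpredT (fun j => is_cderiveM (dG a j) (dH j b)).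
by apply: is_cderive_ext => y; rewrite mxE.
Qed.

Lemma is_cderive_trace n (G : V -> 'M[R[i]]_n) x v B :
  is_mxderive G x v B -> is_cderive (fun y => \tr (G y)) x v (\tr B).
Proof. by move=> dG; apply: is_cderive_sum => i; exact: dG. Qed.

(** Jacobi's formula. The derivative of the Leibniz sum is the sum over i of the
    determinants of the matrices M i, in which row i is replaced by its
    derivative; expanding M i along that row gives the adjugate. *)
Lemma is_cderive_det n (G : V -> 'M[R[i]]_n) x v B :
  is_mxderive G x v B -> is_cderive (fun y => \det (G y)) x v (\tr (\adj (G x) *m B)).
Proof.
move=> dG.
pose M i : 'M[R[i]]_n := \matrix_(r, c) if r == i then B r c else G x r c.
(* the cofactors of row i do not see that row *)
have detM i : \det (M i) = \sum_j B i j * cofactor (G x) i j.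
  rewrite (expand_det_row _ i); apply: eq_bigr => j _.
  rewrite mxE eqxx; congr (_ * (_ * \det _)).
  by apply/matrixP => r c; rewrite !mxE eq_sym (negPf (neq_lift _ _)).
have -> : \tr (\adj (G x) *m B) = \sum_i \det (M i).
  rewrite mxtrace_mulC; apply: eq_bigr => i _; rewrite detM mxE.
  by apply: eq_bigr => j _; rewrite mxE.
rewrite exchange_big /=.
suff H (s : {perm 'I_n}) : is_cderive (fun y => (-1) ^+ s * \prod_i G y i (s i)) x v
    (\sum_i (-1) ^+ s * \prod_j M i j (s j)) by exact: is_cderive_sum.
have := is_cderiveM (is_cderive_cst ((-1) ^+ s) x v)
  (is_cderive_prod (index_enum_uniq 'I_n) (fun i => dG i (s i))).
rewrite mul0r add0r mulr_sumr.
rewrite [X in is_cderive _ x v X](_ : _ = \sum_i (-1) ^+ s * \prod_j M i j (s j))//.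
apply: eq_bigr => i _; rewrite [in RHS](bigD1 i)//= mxE eqxx; congr (_ * (_ * _)).
by apply: eq_bigr => j ji; rewrite mxE (negPf ji).
Qed.

(** Differentiate G G^-1 = 1. *)
Lemma is_mxderive_inv n (G : V -> 'M[R[i]]_n) x v B C :
  (\forall y \near x, G y \in unitmx) ->
  is_mxderive G x v B -> is_mxderive (fun y => invmx (G y)) x v C ->
  C = - (invmx (G x) *m B *m invmx (G x)).
Proof.
move=> uG dG dI; have uGx := nbhs_singleton uG.
have : is_mxderive (fun y => G y *m invmx (G y)) x v 0.
  move=> a b; apply: (@is_cderive_near (fun=> (1%:M : 'M[R[i]]_n) a b)).
    by near=> y; rewrite mulmxV//; near: y.
  by rewrite [X in is_cderive _ _ _ X]mxE; exact: is_cderive_cst.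
move=> /is_mxderive_val E0; have /is_mxderive_val := is_mxderiveM dG dI.
rewrite -E0 => /(congr1 (mulmx (invmx (G x)))).
rewrite mulmx0 mulmxDr !mulmxA mulVmx// mul1mx => /eqP.
by rewrite addrC addr_eq0 => /eqP.
Unshelve. all: by end_near. Qed.

End ComplexCalculus.

(** * Positive hermitian matrices *)

Section PositiveForms.
Context {R : realType}.
Local Notation C := R[i].
Notation Re := complex.Re.
Notation Im := complex.Im.

Lemma cRe_gt0 (a : C) : 0 < a -> 0 < Re a.
Proof. by rewrite ltcE => /andP[]. Qed.

Lemma cRe_sum (I : Type) (s : seq I) (P : pred I) (F : I -> C) :
  Re (\sum_(i <- s | P i) F i) = \sum_(i <- s | P i) Re (F i).
Proof. by elim/big_rec2: _ => // i x y _ <-; rewrite cReD. Qed.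

(** Cauchy-Schwarz, from the nonnegativity of the squares (n c_i - sum c)^2. *)
Lemma sum_sqr_ge (n : nat) (c : 'I_n -> R) :
  (\sum_i c i) ^+ 2 <= n%:R * \sum_i c i ^+ 2.
Proof.
case: n c => [|m] c; first by rewrite !big_ord0 expr0n mul0r.
set S := \sum_i c i; pose k : R := m.+1%:R.
have : 0 <= \sum_i (k * c i - S) ^+ 2 by apply: sumr_ge0 => i _; exact: sqr_ge0.
under eq_bigr => i _.
  rewrite (_ : _ ^+ 2 = k ^+ 2 * c i ^+ 2 + (- (2 * k * S) * c i + S ^+ 2)).
  over.
  by ring.
rewrite !big_split /= sumr_const card_ord -!mulr_sumr -/S -[S ^+ 2 *+ _]mulr_natl -/k.
have -> : k ^+ 2 * (\sum_i c i ^+ 2) + (- (2 * k * S) * S + k * S ^+ 2) =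
  k * (k * (\sum_i c i ^+ 2) - S ^+ 2) by ring.
by rewrite pmulr_rge0 ?ltr0n// subr_ge0.
Qed.

Context {n : nat}.
Implicit Types (G B H P : 'M[C]_n).

Lemma herm_entry B i j : B \is hermsymmx -> B j i = (B i j)^*%C.
Proof. by move=> /is_hermitianmxP; rewrite expr0 scale1r => {1}->; rewrite !mxE. Qed.

Lemma herm_pd_spectral G : herm_pd G ->
  exists (U : 'M[C]_n) (d : 'rV[C]_n),
  [/\ U \is unitarymx, forall i, 0 < d 0 i & G = U ^t* *m diag_mx d *m U].
Proof.
move=> [hG pG]; have uU := spectral_unitarymx G.
exists (spectralmx G), (spectral_diag G); split => //; last first.
  by rewrite -invmx_unitary//; apply/orthomx_spectralP/hermitian_normalmx.
have /hermitian_normalmx/orthomx_spectralP := hG.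
rewrite invmx_unitary//; set U := spectralmx G; set d := spectral_diag G => EG i.
have Uu : U \in unitmx := unitarymx_unit uU.
(* the quadratic form of G at row i of U is the eigenvalue d i *)
have v0 : row i U != 0.
  apply/negP => /eqP r0; have : delta_mx 0 i *m U = (0 : 'rV[C]_n) by rewrite -rowE.
  move=> /(congr1 (mulmx^~ (invmx U))); rewrite mulmxK// mul0mx => /matrixP/(_ 0 i).
  by rewrite !mxE !eqxx /= => /eqP; rewrite oner_eq0.
have UU : U *m U ^t* = 1%:M by apply/unitarymxP.
have := pG _ v0; rewrite {1}EG rowE trmx_mul map_mxM -!mulmxA.
rewrite (mulmxA U (U ^t*) (diag_mx _ *m _)) UU mul1mx (mulmxA U (U ^t*)) UU mul1mx.
rewrite mulmxA -rowE row_diag_mx mxE (bigD1 i)//= big1 ?addr0 => [|j ji].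
  by rewrite !mxE !eqxx /= conjC1 !mulr1.
by rewrite !mxE (negPf ji) andbF mulr0 mul0r.
Qed.

(** P = d^(-1/2) U in the spectral decomposition G = U^* d U. This turns the trace
    of invmx G against a form H into the ordinary trace of P H P^*, that is,
    it writes the form in a unitary frame for G. *)
Lemma herm_pd_factor G : herm_pd G ->
  exists P, [/\ P \in unitmx, G \in unitmx & invmx G = P ^t* *m P].
Proof.
move=> /herm_pd_spectral[U [d [uU d0 EG]]].
have Uu : U \in unitmx := unitarymx_unit uU.
have UU : U *m U ^t* = 1%:M by apply/unitarymxP.
have UU' : U ^t* *m U = 1%:M by rewrite -invmx_unitary// mulVmx.
pose r : 'rV[C]_n := \row_i sqrtC (d 0 i)^-1.
have r0 i : 0 < r 0 i by rewrite mxE sqrtC_gt0 invr_gt0.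
have rr i : (r 0 i)^* * r 0 i = (d 0 i)^-1.
  by rewrite geC0_conj ?ltW// mxE -expr2 sqrtCK.
pose Q := diag_mx r *m U.
have EQ : Q ^t* *m Q = U ^t* *m diag_mx (\row_i (d 0 i)^-1) *m U.
  rewrite /Q trmx_mul map_mxM tr_diag_mx map_diag_mx -!mulmxA; congr (_ *m _).
  rewrite !mulmxA mulmx_diag; congr (diag_mx _ *m _).
  by apply/rowP => i; rewrite !mxE -[RHS]rr !mxE.
have GQ : Q ^t* *m Q *m G = 1%:M.
  rewrite EQ EG -!mulmxA (mulmxA U (U ^t*)) UU mul1mx (mulmxA (diag_mx _)) mulmx_diag.
  rewrite (_ : \row_i _ = const_mx 1) ?diag_const_mx ?mul1mx//.
  by apply/rowP => i; rewrite !mxE mulVf// gt_eqF.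
have [_ uG] := mulmx1_unit GQ.
have iG : invmx G = Q ^t* *m Q.
  by rewrite -[LHS]mul1mx -GQ mulmxK.
exists Q; split => //.
rewrite unitmx_mul Uu andbT unitmxE det_diag unitfE; apply/prodf_neq0 => i _.
by rewrite gt_eqF.
Qed.

Lemma herm_pd_det G : herm_pd G -> 0 < \det G.
Proof.
move=> /herm_pd_spectral[U [d [uU d0 ->]]].
rewrite !det_mulmx mulrAC -det_mulmx -invmx_unitary// mulVmx ?unitarymx_unit//.
by rewrite det1 mul1r det_diag; apply: prodr_gt0.
Qed.

(** tr (P^* P H) = tr (P H P^* ) is the sum of the values of H on the rows of P. *)
Lemma trace_negative G H : herm_pd G ->
  (forall v : 'rV[C]_n, Re ((v *m H *m v ^t*) 0 0) <= 0) ->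
  Re (\tr (invmx G *m H)) <= 0.
Proof.
move=> /herm_pd_factor[P [_ _ ->]] nH.
rewrite -mulmxA mxtrace_mulC /mxtrace cRe_sum; apply: sumr_le0 => i _.
have := nH (row i P); congr (Re _ <= 0).
rewrite -row_mul !mxE; apply: eq_bigr => j _.
by rewrite !mxE.
Qed.

(** |tr_G B|^2 <= n |B|_G^2. In a unitary frame B becomes the hermitian matrix
    D = P B P^*, and tr D^2, the sum of all |D_ij|^2, dominates the sum of the
    squares of the diagonal entries. *)
Lemma trace_sqr_ge G B : herm_pd G -> B \is hermsymmx ->
  (Re (\tr (invmx G *m B))) ^+ 2 <=
  n%:R * Re (\tr (invmx G *m B *m invmx G *m B)).
Proof.
move=> /herm_pd_factor[P [_ _ ->]] hB.
pose D := P *m B *m P ^t*.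
have hD i j : D j i = (D i j)^*%C.
  suff : D \is hermsymmx by exact: herm_entry.
  apply/is_hermitianmxP; rewrite expr0 scale1r /D !trmx_mul !map_mxM -mulmxA.
  by rewrite trmxCK -{1}(_ : B ^t* = B)// {2}(is_hermitianmxP _ _ _ hB) expr0 scale1r.
have -> : \tr (P ^t* *m P *m B) = \tr D by rewrite /D -mulmxA mxtrace_mulC.
have -> : \tr (P ^t* *m P *m B *m (P ^t* *m P) *m B) = \tr (D *m D).
  by rewrite /D -!mulmxA [LHS]mxtrace_mulC -!mulmxA.
clearbody D.
rewrite {1}/mxtrace cRe_sum (le_trans (sum_sqr_ge _))// ler_wpM2l//.
rewrite /mxtrace cRe_sum ler_sum// => i _.
have sq (a : C) : Re (a * a^*%C) = Re a ^+ 2 + Im a ^+ 2.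
  by case: a => a b /=; rewrite mulrN opprK.
rewrite [(D *m D) i i]mxE cRe_sum (bigD1 i)//= {3}hD sq -addrA lerDl.
rewrite addr_ge0 ?sqr_ge0// sumr_ge0// => j _.
by rewrite [D j i]hD sq addr_ge0 ?sqr_ge0.
Qed.

End PositiveForms.

(** * The complex Hessian *)

Section LeviForm.
Context {R : realType} {n : nat}.

(** The matrix with entries (X_a - i Y_a)(X_b + i Y_b) f / 4, that is the matrix
    of sqrt(-1) ddbar f when X and Y are the coordinate directions. The frame
    is left arbitrary so that the same expression makes sense on space-time,
    where X and Y are the spatial directions only. *)
Definition levi {V : normedModType R} (X Y : 'I_n -> V) (f : V -> R) (p : V) : 'M[R[i]]_n :=
  \matrix_(a, b)
    ((4^-1 * ('D_(X a) ('D_(X b) f) p + 'D_(Y a) ('D_(Y b) f) p)) +i*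
     (4^-1 * ('D_(X a) ('D_(Y b) f) p - 'D_(Y a) ('D_(X b) f) p))).

Lemma inv2C : (2^-1 : R[i]) = (2^-1 : R)%:C.
Proof. by rewrite -[2 in LHS](rmorphMn (real_complex R) 2 1) fmorphV. Qed.

Lemma wirtinger_half (p q r s : R) :
  (2^-1)%:C * ((2^-1 * p) +i* (2^-1 * q) - 'i * ((2^-1 * r) +i* (2^-1 * s)))
  = (4^-1 * (p + s)) +i* (4^-1 * (q - r)).
Proof. by apply: complex_eqP; rewrite ?(cReM, cImM, cReD, cImD, cReN, cImN) /=; field. Qed.

Lemma ddbarE (U : set (Cn R n)) (u : Cn R n -> R) z : open U -> smooth_on U u -> U z ->
  ddbar u z = levi (@xdir R n) (@ydir R n) u z.
Proof.
move=> oU su Uz; apply/matrixP => a b; rewrite !mxE.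
have D0 (v w : Cn R n) : 'D_v (fun=> 0 : R) w = 0 by exact: derive_cst.
have E : dzbar b (fun w => (u w)%:C) =
    fun w => (2^-1 * 'D_(xdir b) u w) +i* (2^-1 * 'D_(ydir b) u w).
  apply/funext => w; rewrite /dzbar /cderive /= !D0 inv2C.
  rewrite (_ : [eta u] = u)//.
  by apply: complex_eqP; rewrite ?(cReM, cImM, cReD, cImD) /=; ring.
have DZ (v w : Cn R n) : is_derive z v (fun y => 2^-1 * 'D_w u y) (2^-1 * 'D_v ('D_w u) z).
  apply: (is_deriveZ (2^-1)); apply: derivableP; apply: smooth_derivable Uz; exact: smooth_derive.
have H (v : Cn R n) : cderive v (fun w => (2^-1 * 'D_(xdir b) u w) +i* (2^-1 * 'D_(ydir b) u w)) z
   = (2^-1 * 'D_v ('D_(xdir b) u) z) +i* (2^-1 * 'D_v ('D_(ydir b) u) z).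
  apply: is_cderive_val; split; exact: DZ.
rewrite E /dz !H inv2C.
exact: wirtinger_half.
Qed.

End LeviForm.

Lemma is_derive_ext {R : realType} {V : normedModType R} (f g : V -> R) x v (d e : R) :
  (forall y, f y = g y) -> d = e -> is_derive x v f d -> is_derive x v g e.
Proof. by move=> /funext -> ->. Qed.

Section LeviCalculus.
Context {R : realType} {n : nat} {V : normedModType R}.
Variables X Y : 'I_n -> V.
Implicit Types (U : set V) (f : V -> R).
Notation Re := complex.Re.
Notation Im := complex.Im.

Lemma csmooth_levi U f a b : open U -> smooth_on U f ->
  csmooth_on U (fun p => levi X Y f p a b).
Proof.
move=> oU sf.
have s2 u v : smooth_on U ('D_u ('D_v f)) by do 2 apply: smooth_derive; exact: sf.
have s4 : smooth_on U (fun=> 4^-1 : R) by exact: smooth_cst.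
split.
  apply: smooth_ext (smoothM oU s4 (smoothD oU (s2 (X a) (X b)) (s2 (Y a) (Y b)))) => // p _.
  by rewrite mxE.
apply: smooth_ext (smoothM oU s4 (smoothD oU (s2 (X a) (Y b)) (smoothN oU (s2 (Y a) (X b))))) => // p _.
by rewrite mxE.
Qed.

(** T commutes with each of the two derivatives of the Hessian. *)
Lemma is_mxderive_levi U f p (T : V) : open U -> smooth_on U f -> U p ->
  is_mxderive (levi X Y f) p T (levi X Y ('D_T f) p).
Proof.
move=> oU sf Up a b.
have D3 u v : is_derive p T ('D_u ('D_v f)) ('D_u ('D_v ('D_T f)) p).
  have sv : smooth_on U ('D_v f) by exact: smooth_derive.
  have suv : smooth_on U ('D_u ('D_v f)) by exact: smooth_derive.
  apply: is_derive_eq (derivableP (smooth_derivable suv Up)) _.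
  have C1 : 'D_T ('D_u ('D_v f)) p = 'D_u ('D_T ('D_v f)) p.
    exact: (@smooth_derive_comm _ _ U ('D_v f)).
  have C2 : 'D_u ('D_T ('D_v f)) p = 'D_u ('D_v ('D_T f)) p.
    apply: near_eq_derive; apply: (open_near oU Up) => q Uq.
    exact: (@smooth_derive_comm _ _ U f).
  exact (etrans C1 C2).
split.
  apply: is_derive_ext (is_deriveZ (4^-1) (is_deriveD (D3 (X a) (X b)) (D3 (Y a) (Y b)))).
    by move=> q; rewrite mxE.
  by rewrite mxE.
apply: is_derive_ext (is_deriveZ (4^-1) (is_deriveB (D3 (X a) (Y b)) (D3 (Y a) (X b)))).
  by move=> q; rewrite mxE.
by rewrite mxE.
Qed.

(** The term of index (a, b) in the identity that proves levi_at_max. *)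
Lemma levi_term (va vb : R[i]) (xx xy yx yy : R) :
  Re (va * ((4^-1 * (xx + yy)) +i* (4^-1 * (xy - yx))) * vb^*%R) =
  4^-1 * (Re va * (Re vb * xx + Im vb * xy) + Im va * (Re vb * yx + Im vb * yy) +
    (Im va * (Im vb * xx + - Re vb * xy) + - Re va * (Im vb * yx + - Re vb * yy))).
Proof. by case: va vb => [pa qa] [pb qb] /=; ring. Qed.

(** Put v = p + i q. The real and imaginary parts of sum v_a (X_a - i Y_a) are
    P = sum (p_a X_a + q_a Y_a) and Q = sum (q_a X_a - p_a Y_a), so the value of the
    complex Hessian on v is (D_P D_P f + D_Q D_Q f) / 4, to which the second
    derivative test applies. *)
Lemma levi_at_max U f z : open U -> smooth_on U f -> U z ->
  (\forall y \near z, f y <= f z) ->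
  forall v : 'rV[R[i]]_n, Re ((v *m levi X Y f z *m v ^t*) 0 0) <= 0.
Proof.
move=> oU sf Uz fmax v.
pose p a := Re (v 0 a); pose q a := Im (v 0 a).
have comb (c d : 'I_n -> R) g w : smooth_on U g -> U w ->
  'D_(\sum_a c a *: X a + \sum_a d a *: Y a) g w =
    \sum_a (c a * 'D_(X a) g w + d a * 'D_(Y a) g w).
  move=> sg Uw; rewrite -[\sum_a c a *: X a]scale1r (smooth_derive_linear _ _ _ oU sg Uw).
  by rewrite mul1r !(smooth_derive_sum _ _ _ oU sg Uw) big_split.
have comb2 (c d : 'I_n -> R) (P := \sum_a c a *: X a + \sum_a d a *: Y a) :
  'D_P ('D_P f) z = \sum_a \sum_b
    (c a * (c b * 'D_(X a) ('D_(X b) f) z + d b * 'D_(X a) ('D_(Y b) f) z)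
   + d a * (c b * 'D_(Y a) ('D_(X b) f) z + d b * 'D_(Y a) ('D_(Y b) f) z)).
  rewrite (comb c d _ z (smooth_derive P sf) Uz); apply: eq_bigr => a _.
  have sw w : 'D_w ('D_P f) z =
      \sum_b (c b * 'D_w ('D_(X b) f) z + d b * 'D_w ('D_(Y b) f) z).
    rewrite (smooth_derive_comm _ _ oU sf Uz) (comb c d _ z (smooth_derive w sf) Uz).
    apply: eq_bigr => b _.
    by rewrite (smooth_derive_comm w (X b) oU sf Uz) (smooth_derive_comm w (Y b) oU sf Uz).
  by rewrite (sw (X a)) (sw (Y a)) !mulr_sumr big_split.
have neg w : 'D_w ('D_w f) z <= 0.
  apply: derive2_at_max fmax.
    by apply: open_near oU Uz _ => y Uy; exact: smooth_derivable sf Uy.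
  exact: smooth_derivable (smooth_derive w sf) Uz.
have H : 'D_(\sum_a p a *: X a + \sum_a q a *: Y a)
            ('D_(\sum_a p a *: X a + \sum_a q a *: Y a) f) z +
         'D_(\sum_a q a *: X a + \sum_a (- p a) *: Y a)
            ('D_(\sum_a q a *: X a + \sum_a (- p a) *: Y a) f) z <= 0.
  by rewrite -[leRHS]addr0 lerD.
suff -> : Re ((v *m levi X Y f z *m v ^t*) 0 0) = 4^-1 *
   ('D_(\sum_a p a *: X a + \sum_a q a *: Y a)
            ('D_(\sum_a p a *: X a + \sum_a q a *: Y a) f) z +
         'D_(\sum_a q a *: X a + \sum_a (- p a) *: Y a)
            ('D_(\sum_a q a *: X a + \sum_a (- p a) *: Y a) f) z).
  by rewrite pmulr_rle0.
rewrite (comb2 p q) (comb2 q (fun a => - p a)) -big_split /= mulr_sumr.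
rewrite mxE cRe_sum.
under eq_bigr => b _ do rewrite mxE mulr_suml cRe_sum.
rewrite exchange_big /=; apply: eq_bigr => a _.
rewrite -big_split /= mulr_sumr; apply: eq_bigr => b _.
have vbE : (v ^t*) b 0 = (v 0 b)^* by rewrite !mxE.
have hE : levi X Y f z a b = (4^-1 * ('D_(X a) ('D_(X b) f) z + 'D_(Y a) ('D_(Y b) f) z)) +i*
     (4^-1 * ('D_(X a) ('D_(Y b) f) z - 'D_(Y a) ('D_(X b) f) z)) by rewrite mxE.
rewrite vbE hE; exact: levi_term.
Qed.

End LeviCalculus.

Section SpaceTime.
Context {R : realType} {n : nat}.
Notation E := (R^o * Cn R n)%type.

Lemma space_quotientE (F : E -> R) (t : R^o) (z v : Cn R n) :
  (fun h : R => h^-1 *: ((F \o shift ((t, z) : E)) (h *: ((0, v) : E)) - F (t, z)))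
  = (fun h : R => h^-1 *: (((fun w => F (t, w)) \o shift z) (h *: v) - F (t, z))).
Proof.
apply/funext => h; congr (_ *: (F _ - _)).
by congr pair; rewrite /= scaler0 add0r.
Qed.

Lemma derive_space (F : E -> R) (t : R^o) (z v : Cn R n) :
  'D_((0, v) : E) F (t, z) = 'D_v (fun w => F (t, w)) z.
Proof. by rewrite /derive space_quotientE. Qed.

Lemma derivable_space (F : E -> R) (t : R^o) (z v : Cn R n) :
  derivable F (t, z) ((0, v) : E) -> derivable (fun w => F (t, w)) z v.
Proof. by rewrite /derivable space_quotientE. Qed.

Lemma is_derive_time (F : E -> R) (t : R^o) (z : Cn R n) (d : R) :
  is_derive ((t, z) : E) ((1, 0) : E) F d <->
  is_derive t (1 : R^o) (fun s : R^o => F (s, z)) d.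
Proof.
have Q : (fun h : R => h^-1 *: ((F \o shift ((t, z) : E)) (h *: ((1, 0) : E)) - F (t, z)))
  = (fun h : R => h^-1 *: (((fun s : R^o => F (s, z)) \o shift t) (h *: (1 : R^o)) - F (t, z))).
  apply/funext => h; congr (_ *: (F _ - _)).
  by congr pair; rewrite /= scaler0 add0r.
by split=> -[]; rewrite /derivable /derive => df Df; split;
   rewrite /derivable /derive; move: df Df; rewrite Q.
Qed.

Lemma continuous_space_slice (t : R^o) : continuous (fun z : Cn R n => (t, z) : E).
Proof.
move=> z; apply: (@cvg_pair _ _ _ (nbhs z) (nbhs t) (nbhs z) _ _ _ (fun=> t) id).
  exact: cvg_cst.
exact: cvg_id.
Qed.

Lemma smooth_slice (U : set E) (F : E -> R) (t : R^o) :
  smooth_on U F -> smooth_on [set z | U (t, z)] (fun z => F (t, z)).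
Proof.
move=> sF k; move: (sF k); elim: k F {sF} => [|k IH] F [cF dF].
- split => // z /= Uz; apply: (@continuous_comp _ _ _ (fun z : Cn R n => (t, z) : E) F).
    exact: continuous_space_slice.
  exact: cF.
- split => [z /= Uz|v].
    apply: (@continuous_comp _ _ _ (fun z : Cn R n => (t, z) : E) F).
      exact: continuous_space_slice.
    exact: cF.
  have [dFv CF] := dF ((0, v) : E); split.
    move=> z /= Uz; apply: derivable_space; exact: dFv.
  have := IH _ CF; congr Ck; apply/funext => z; exact: derive_space.
Qed.

Lemma smooth_snd (U : set E) (W : set (Cn R n)) (f : Cn R n -> R) :
  (forall p, U p -> W p.2) -> smooth_on W f -> smooth_on U (fun p => f p.2).
Proof.
move=> UW sf k; move: (sf k); elim: k f {sf} => [|k IH] f [cf df].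
- split => // p Up; apply: (@continuous_comp _ _ _ (@snd R^o (Cn R n)) f).
    exact: cvg_snd.
  exact/cf/UW.
- split => [p Up|v].
    apply: (@continuous_comp _ _ _ (@snd R^o (Cn R n)) f).
      exact: cvg_snd.
    exact/cf/UW.
  have [dfv Cf] := df v.2; split; first by move=> p /UW; exact: dfv.
  exact: IH Cf.
Qed.

Lemma levi_space (X Y : 'I_n -> Cn R n) (F : E -> R) (t : R^o) (z : Cn R n) :
  levi (fun a => (0, X a) : E) (fun a => (0, Y a) : E) F (t, z) =
  levi X Y (fun w => F (t, w)) z.
Proof.
have D2 (u v : Cn R n) : 'D_((0, u) : E) ('D_((0, v) : E) F) (t, z) =
    'D_u ('D_v (fun w => F (t, w))) z.
  have D1 : (fun w => 'D_((0, v) : E) F (t, w)) = 'D_v (fun w => F (t, w)).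
    by apply/funext => w; exact: derive_space.
  by rewrite (derive_space ('D_((0, v) : E) F) t z u) D1.
apply/matrixP => a b; rewrite [LHS]mxE [RHS]mxE.
have h1 := D2 (X a) (X b); have h2 := D2 (Y a) (Y b).
have h3 := D2 (X a) (Y b); have h4 := D2 (Y a) (X b).
exact (f_equal2 (@Complex R) (f_equal (fun r : R => 4^-1 * r) (f_equal2 (fun r s : R => r + s) h1 h2))
  (f_equal (fun r : R => 4^-1 * r) (f_equal2 (fun r s : R => r - s) h3 h4))).
Qed.

End SpaceTime.

(** * Evolution of the logarithm of the determinant *)

Section MatrixDerivatives.
Context {R : realType} {V : normedModType R}.
Implicit Types (x v : V).
Notation Re := complex.Re.
Notation Im := complex.Im.

Lemma is_mxderiveD m n (G H : V -> 'M[R[i]]_(m, n)) x v B C :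
  is_mxderive G x v B -> is_mxderive H x v C ->
  is_mxderive (fun y => G y + H y) x v (B + C).
Proof.
move=> dG dH a b; rewrite mxE.
by apply: is_cderive_ext (is_cderiveD (dG a b) (dH a b)) => y; rewrite mxE.
Qed.

Lemma is_mxderiveZ m n (k : R[i]) (G : V -> 'M[R[i]]_(m, n)) x v B :
  is_mxderive G x v B -> is_mxderive (fun y => k *: G y) x v (k *: B).
Proof.
move=> dG a b; rewrite mxE.
have := is_cderiveM (is_cderive_cst k x v) (dG a b).
by rewrite mul0r add0r; apply: is_cderive_ext => y; rewrite mxE.
Qed.

Lemma is_mxderive_sandwich m n (J : 'M[R[i]]_(m, n)) (K : 'M[R[i]]_(n, m))
    (G : V -> 'M[R[i]]_n) x v B :
  is_mxderive G x v B -> is_mxderive (fun y => J *m G y *m K) x v (J *m B *m K).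
Proof.
move=> dG.
have cst p q (L : 'M[R[i]]_(p, q)) : is_mxderive (fun=> L) x v 0.
  by move=> a b; rewrite [X in is_cderive _ _ _ X]mxE; exact: is_cderive_cst.
have := is_mxderiveM (is_mxderiveM (cst _ _ J) dG) (cst _ _ K).
by rewrite mul0mx add0r mulmx0 addr0.
Qed.

Lemma is_mxderive_near m n (G H : V -> 'M[R[i]]_(m, n)) x v B :
  (\forall y \near x, G y = H y) -> is_mxderive G x v B -> is_mxderive H x v B.
Proof.
move=> GH dG a b; apply: is_cderive_near (dG a b).
by apply: filterS GH => y ->.
Qed.

Lemma csmooth_is_mxderive U m n (G : V -> 'M[R[i]]_(m, n)) x v :
  (forall a b, csmooth_on U (fun y => G y a b)) -> U x ->
  is_mxderive G x v (mxderive v G x).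
Proof. by move=> sG Ux a b; rewrite mxE; exact: csmooth_is_cderive (sG a b) Ux. Qed.

Lemma hermsymmx_mxderive U n (G : V -> 'M[R[i]]_n) x v : open U -> U x ->
  (forall a b, csmooth_on U (fun y => G y a b)) ->
  (forall y, U y -> G y \is hermsymmx) -> mxderive v G x \is hermsymmx.
Proof.
move=> oU Ux sG hG; apply/is_hermitianmxP; rewrite expr0 scale1r.
have Gba a b y : U y -> G y a b = (G y b a)^*%C by move=> /hG; exact: herm_entry.
apply/matrixP => a b; rewrite !mxE.
have [rG iG] := sG b a.
apply: is_cderive_val.
have [r i] := csmooth_is_cderive v (sG b a) Ux.
apply: (@is_cderive_near _ _ (fun y => (G y b a)^*%C)).
  by apply: open_near oU Ux _ => y Uy; rewrite -Gba.
split.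
  apply: is_derive_ext r => [y|]; last by [].
  by case: (G y b a).
apply: is_derive_ext (is_deriveN i) => [y|]; last by [].
rewrite -[LHS]/(- Im (G y b a)); by case: (G y b a).
Qed.

End MatrixDerivatives.

Section LogDeterminantFlow.
Context {R : realType} {V : normedModType R} {n : nat}.
Variables (U : set V) (X Y : 'I_n -> V) (T : V) (G Theta : V -> 'M[R[i]]_n) (mu : R).
Notation Re := complex.Re.
Notation Im := complex.Im.
Hypothesis oU : open U.
Hypothesis sG : forall a b, csmooth_on U (fun p => G p a b).
Hypothesis pG : forall p, U p -> herm_pd (G p).

Definition log_det p : R := ln (Re (\det (G p))).

Lemma smooth_log_det : smooth_on U log_det.
Proof.
apply: smooth_ln => //; first by move=> p /pG /herm_pd_det /cRe_gt0.
by have [] := csmooth_det oU sG.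
Qed.

(** Jacobi's formula; the determinant is real, so it can be taken out of Re. *)
Lemma derive_log_det p : U p ->
  'D_T log_det p = Re (\tr (invmx (G p) *m mxderive T G p)).
Proof.
move=> Up; have dG := csmooth_is_mxderive T sG Up.
have det0 := herm_pd_det (pG Up).
have [rdet _] := is_cderive_det dG.
have d0 := cRe_gt0 det0.
have [_ ->] := is_derive_chain rdet (is_derive1_ln d0).
have [P [_ uG _]] := herm_pd_factor (pG Up).
have detE : \det (G p) = (Re (\det (G p)))%:C.
  apply: complex_eqP => //=; move: det0; rewrite ltcE => /andP[/eqP + _].
  by move=> ->.
rewrite /invmx uG -scalemxAl mxtraceZ.
set c := \tr _; rewrite [in RHS]detE -fmorphV cReM /=.
by rewrite mul0r subr0.
Qed.

Hypothesis flow : forall p, U p ->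
  mxderive T G p = levi X Y log_det p + mu%:C *: G p + Theta p.
Hypothesis Theta_static : forall p, U p -> is_mxderive Theta p T 0.

(** With w = 'D_T log_det = tr (G^-1 G') and G'' = levi w + mu G' (the flow
    equation differentiated along T), the derivative of w is
      tr (G^-1 G'') - tr (G^-1 G' G^-1 G') = tr (G^-1 levi w) + mu w - |G'|^2 ,
    and trace_sqr_ge bounds n |G'|^2 below by w^2. The factor n is kept on the
    left so that the inequality also makes sense for n = 0. *)
Lemma log_det_flow_ineq p : U p ->
  n%:R * 'D_T ('D_T log_det) p <=
  n%:R * Re (\tr (invmx (G p) *m levi X Y ('D_T log_det) p)) +
  n%:R * (mu * 'D_T log_det p) - ('D_T log_det p) ^+ 2.
Proof.
move=> Up; have dG := csmooth_is_mxderive T sG Up.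
have uG q : U q -> G q \in unitmx by move=> /pG /herm_pd_factor[P []].
have sI := csmooth_invmx oU uG sG.
have dI := csmooth_is_mxderive T sI Up.
have EI := is_mxderive_inv (open_near oU Up uG) dG dI.
rewrite EI in dI.
set D := mxderive T G p in dG EI dI.
have dD : is_mxderive (mxderive T G) p T (levi X Y ('D_T log_det) p + mu%:C *: D).
  have d1 := is_mxderive_levi X Y T oU smooth_log_det Up.
  have := is_mxderiveD (is_mxderiveD d1 (is_mxderiveZ mu%:C dG)) (Theta_static Up).
  rewrite addr0; apply: is_mxderive_near.
  by apply: open_near oU Up _ => q Uq; rewrite flow.
have [dw _] := is_cderive_trace (is_mxderiveM dI dD).
have {}dw := near_eq_is_derive _ dw.
have [|_ Dw] := dw ('D_T log_det).
  by apply: open_near oU Up _ => q Uq; rewrite derive_log_det.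
have wE := derive_log_det Up; rewrite -/D in wE.
have hD : D \is hermsymmx.
  by apply: hermsymmx_mxderive oU Up sG _ => q /pG[].
have CS := trace_sqr_ge (pG Up) hD; rewrite -wE in CS.
have {}Dw : 'D_T ('D_T log_det) p =
    - Re (\tr (invmx (G p) *m D *m invmx (G p) *m D))
    + (Re (\tr (invmx (G p) *m levi X Y ('D_T log_det) p)) + mu * 'D_T log_det p).
  rewrite Dw mulNmx mulmxDr -scalemxAr mxtraceD raddfN mxtraceD mxtraceZ !cReD cReN cReM.
  by rewrite wE /= mul0r subr0.
rewrite Dw !mulrDr mulrN addrC lerD2l lerN2; exact: CS.
Qed.

End LogDeterminantFlow.

(** * The twisted flow on a compact manifold *)

Lemma trace_pullback {C : fieldType} n (J K G D : 'M[C]_n) :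
  J *m G *m K \in unitmx ->
  \tr (invmx (J *m G *m K) *m (J *m D *m K)) = \tr (invmx G *m D).
Proof.
rewrite !unitmx_mul => /andP[/andP[uJ uG] uK].
have -> : invmx (J *m G *m K) = invmx K *m invmx G *m invmx J.
  have uA : J *m G *m K \in unitmx by rewrite !unitmx_mul uJ uG uK.
  apply: (can_inj (mulmxK uA)); rewrite mulVmx// !mulmxA.
  by rewrite mulmxKV// -(mulmxA _ (invmx G)) mulVmx// mulmx1 mulVmx.
rewrite !mulmxA (mulmxKV uJ) -!mulmxA mxtrace_mulC !mulmxA mulmxK//.
Qed.

(** Let s = w - N mu and suppose k s > N, so that s > 0. The differential inequality
    gives N D <= - w s <= - s^2; multiplying 0 <= k D + s by N then gives
    0 <= s (N - k s), which is absurd. *)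
Lemma max_point_bound {R : realFieldType} (N mu k L D w : R) :
  0 <= N -> 0 <= mu -> 0 < k -> L <= 0 ->
  N * D <= N * L + N * (mu * w) - w ^+ 2 ->
  0 <= k * D + (w - N * mu) -> k * (w - N * mu) <= N.
Proof.
move=> N0 m0 k0 L0 ineq tmax; rewrite leNgt; apply/negP => big.
set sg := w - N * mu in tmax big.
have sg0 : 0 < sg by rewrite -(pmulr_rgt0 _ k0); exact: le_lt_trans big.
have wE : w = sg + N * mu by rewrite /sg subrK.
have Nm0 : 0 <= N * mu := mulr_ge0 N0 m0.
have ND : N * D <= - sg ^+ 2.
  apply: le_trans ineq _.
  have NL : N * L <= 0 by rewrite mulr_ge0_le0.
  have sNm : 0 <= sg * (N * mu) by rewrite mulr_ge0// ltW.
  rewrite wE; nra.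
have h1 : 0 <= N * (k * D + sg) := mulr_ge0 N0 tmax.
have h2 : k * (N * D) <= k * (- sg ^+ 2) by rewrite ler_pM2l.
have h3 : 0 < sg * (k * sg - N) by rewrite mulr_gt0// subr_gt0.
nra.
Qed.

(** For a metric G moving by G' = - rho + mu G + c th, the trace of rho - c th is
    that of mu G - G'. *)
Lemma re_trace_combination {R : realType} n (G rho th : 'M[R[i]]_n) (mu c : R) :
  G \in unitmx ->
  complex.Re (\tr (invmx G *m rho)) - c * complex.Re (\tr (invmx G *m th)) =
  n%:R * mu - complex.Re (\tr (invmx G *m (- rho + mu%:C *: G + c%:C *: th))).
Proof.
move=> uG; rewrite !mulmxDr mulmxN -!scalemxAr mulVmx// !mxtraceD !mxtraceZ mxtrace1.
rewrite raddfN !cReD cReN !cReM /= !mul0r !subr0.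
have -> : complex.Re (n%:R : R[i]) = n%:R by rewrite -(rmorph_nat (real_complex R)).
ring.
Qed.

Lemma bound_after_time_one {R : realFieldType} (N t d : R) :
  0 <= N -> 1 <= t -> (t - 2^-1) * d <= N -> - (4 * N) <= - d.
Proof.
move=> N0 t1 bound; rewrite lerN2 leNgt; apply/negP => big.
have d0 : 0 <= d by lra.
have h1 : 0 <= (t - 1) * d by rewrite mulr_ge0// subr_ge0.
have E : (t - 2^-1) * d = (t - 1) * d + d / 2 by field.
rewrite E in bound; lra.
Qed.

Section TwistedFlow.
Context {R : realType} {n : nat} {M : ptopologicalType} (A : complex_atlas R n M).
Variables (omega0 : form11 A) (mu gamma : R) (th : form11 A) (phi : R -> M -> R).
Notation Re := complex.Re.
Notation Im := complex.Im.
Notation E := (R^o * Cn R n)%type.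
Notation T := ((1, 0) : E).
Notation coord := (@Defs.coord R n M A).
Notation X := (fun a : 'I_n => (0, xdir a) : E).
Notation Y := (fun a : 'I_n => (0, ydir a) : E).

Hypothesis smooth_omega0 : forall i a b, csmooth_on (@cod R n M A i) (fun z => omega0 i z a b).
Hypothesis smooth_phi : forall i,
  smooth_on [set tz : R^o * Cn R n | 0 < tz.1 /\ cod i tz.2]
            (fun tz => phi tz.1 (@param R n M A i tz.2)).
Hypothesis Kahler_phi : forall t, 0 < t -> Kahler_metric (deform omega0 (phi t)).
Hypothesis flow_phi : forall t i z (a b : 'I_n), 0 < t -> cod i z ->
  cderive (1 : R^o) (fun s : R^o => deform omega0 (phi s) i z a b) t
  = (- Ric_form (deform omega0 (phi t)) i z
     + mu%:C *: deform omega0 (phi t) i z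
     + (1 - gamma)%:C *: th i z) a b.

Definition spacetime (i : chart A) : set E := [set tz : E | 0 < tz.1 /\ cod i tz.2].
Definition evolving (i : chart A) (p : E) : 'M[R[i]]_n := deform omega0 (phi p.1) i p.2.

Lemma open_spacetime i : open (spacetime i).
Proof.
rewrite (_ : spacetime i = (fst @^-1` [set t : R^o | 0 < t]) `&` (snd @^-1` cod i))//.
apply: openI; apply: open_comp => //.
- by move=> p _; exact: cvg_fst.
- by move=> p _; exact: cvg_snd.
- exact: cod_open.
Qed.

Lemma evolving_levi i p : spacetime i p -> evolving i p =
  omega0 i p.2 + levi X Y (fun q => phi q.1 (param i q.2)) p.
Proof.
case: p => t z [/= t0 cz]; rewrite /evolving /deform /=; congr (_ + _).
rewrite levi_space; apply: (ddbarE (U := cod i)) => //; first exact: cod_open.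
have := smooth_slice t (@smooth_phi i).
by rewrite (_ : [set _ | _] = cod i)//; apply/seteqP; split => [w []|w].
Qed.

Lemma csmooth_evolving i a b : csmooth_on (spacetime i) (fun p => evolving i p a b).
Proof.
have oS := @open_spacetime i.
have s0 : csmooth_on (spacetime i) (fun p => omega0 i p.2 a b).
  have [r im] := smooth_omega0 i a b.
  by split; [apply: smooth_snd r => p []|apply: smooth_snd im => p []].
have sl := csmooth_levi X Y a b oS (@smooth_phi i).
by apply: csmooth_ext (csmoothD oS s0 sl) => // p Sp; rewrite evolving_levi// [RHS]mxE.
Qed.

Lemma herm_pd_evolving i p : spacetime i p -> herm_pd (evolving i p).
Proof. by case=> t0 cz; have [_ _] := Kahler_phi t0; exact. Qed.

Lemma is_mxderive_time i t z (B : 'M[R[i]]_n) : is_mxderive (evolving i) (t, z) T B <->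
  is_mxderive (fun s : R^o => evolving i (s, z)) t 1 B.
Proof.
split=> H a b; have [r im] := H a b; split.
- exact: (proj1 (is_derive_time (fun p => Re (evolving i p a b)) t z _) r).
- exact: (proj1 (is_derive_time (fun p => Im (evolving i p a b)) t z _) im).
- exact: (proj2 (is_derive_time (fun p => Re (evolving i p a b)) t z _) r).
- exact: (proj2 (is_derive_time (fun p => Im (evolving i p a b)) t z _) im).
Qed.

Lemma is_mxderive_evolving i t z : spacetime i (t, z) ->
  is_mxderive (fun s : R^o => evolving i (s, z)) t 1 (mxderive T (evolving i) (t, z)).
Proof.
move=> Sp; apply/is_mxderive_time.
exact: csmooth_is_mxderive (@csmooth_evolving i) Sp.
Qed.

(** At a fixed time, - Ric is by definition the complex Hessian of log det in the
    spatial variables. *)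
Lemma evolving_flow i p : spacetime i p -> mxderive T (evolving i) p =
  levi X Y (log_det (evolving i)) p + mu%:C *: evolving i p + (1 - gamma)%:C *: th i p.2.
Proof.
case: p => t z Sp; have [/= t0 cz] := Sp.
have -> : levi X Y (log_det (evolving i)) (t, z) = - Ric_form (deform omega0 (phi t)) i z.
  rewrite levi_space /Ric_form /Ric opprK; apply/esym.
  apply: (ddbarE (U := cod i)) => //; first exact: cod_open.
  have := smooth_slice t (smooth_log_det (@open_spacetime i) (@csmooth_evolving i) (@herm_pd_evolving i)).
  by rewrite (_ : [set _ | _] = cod i)//; apply/seteqP; split => [w []|w].
apply/matrixP => a b; rewrite -flow_phi//.
by rewrite -(is_cderive_val (is_mxderive_evolving Sp a b)).
Qed.

(** The growth rate of the volume form of the evolving metric, read in a chart. *)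
Definition volume_growth (i : chart A) : E -> R := 'D_T (log_det (evolving i)).

Lemma smooth_volume_growth i : smooth_on (spacetime i) (volume_growth i).
Proof.
apply: smooth_derive.
exact: smooth_log_det (@open_spacetime i) (@csmooth_evolving i) (@herm_pd_evolving i).
Qed.

Lemma volume_growthE i p : spacetime i p ->
  volume_growth i p = Re (\tr (invmx (evolving i p) *m mxderive T (evolving i) p)).
Proof.
move=> Sp; apply: (derive_log_det T _ _ Sp); first exact: csmooth_evolving.
exact: herm_pd_evolving.
Qed.

Lemma volume_growth_ineq i p : spacetime i p ->
  n%:R * 'D_T (volume_growth i) p <=
  n%:R * Re (\tr (invmx (evolving i p) *m levi X Y (volume_growth i) p)) +
  n%:R * (mu * volume_growth i p) - volume_growth i p ^+ 2.
Proof.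
apply: (log_det_flow_ineq (@open_spacetime i) (@csmooth_evolving i)
  (@herm_pd_evolving i) (@evolving_flow i)).
move=> [t z] Sp a b; rewrite [X in is_cderive _ _ _ X]mxE; split.
- by apply/is_derive_time; exact: (is_derive_cst (Re (((1 - gamma)%:C *: th i z) a b)) t (1 : R^o)).
- by apply/is_derive_time; exact: (is_derive_cst (Im (((1 - gamma)%:C *: th i z) a b)) t (1 : R^o)).
Qed.

(** The metric and its time derivative are multiplied by the same constant
    matrices under a change of chart, because the Jacobian does not depend on
    time; the trace does not see them. *)
Lemma volume_growth_transition i j t z : 0 < t -> overlap i j z ->
  volume_growth i (t, z) = volume_growth j (t, transition i j z).
Proof.
move=> t0 ov; have [ci dj] := ov; set z' := transition i j z.
have Si : spacetime i (t, z) by [].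
have Sj : spacetime j (t, z').
  by split => //; exact: coord_cod.
rewrite (volume_growthE Si) (volume_growthE Sj).
pose J := (jac i j z)^T; pose K := map_mx Num.conj (jac i j z).
have EG (s : R) : 0 < s -> evolving i (s, z) = J *m evolving j (s, z') *m K.
  by move=> s0; have [[_ _]] := Kahler_phi s0; move/(_ i j z ov).
have dGi : mxderive T (evolving i) (t, z) = J *m mxderive T (evolving j) (t, z') *m K.
  rewrite [RHS](is_mxderive_val (v := (1 : R^o)) (x := t) (G := fun s : R^o => evolving i (s, z))).
    exact: is_mxderive_val (is_mxderive_evolving Si).
  apply: is_mxderive_near (is_mxderive_sandwich J K (is_mxderive_evolving Sj)).
  near=> s; apply/esym/EG; near: s; exact: lt_nbhsr.
have uG : evolving i (t, z) \in unitmx.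
  by have [P []] := herm_pd_factor (herm_pd_evolving Si).
have EGt := EG t t0; rewrite EGt in uG.
have key := trace_pullback (mxderive T (evolving j) (t, z')) uG.
refine (f_equal (@complex.Re R) (etrans _ key)).
exact (f_equal2 (fun G D => \tr (invmx G *m D)) EGt dGi).
Unshelve. all: by end_near. Qed.

Definition chart_at (x : M) : chart A := projT1 (cid (dom_cover A x)).

Lemma dom_chart_at x : dom (chart_at x) x.
Proof. exact: projT2 (cid (dom_cover A x)). Qed.

(** The function on space-time given by the local growth rates; by growthE the
    chart chosen at each point is immaterial. *)
Definition growth (p : R^o * M) : R :=
  volume_growth (chart_at p.2) (p.1, coord (chart_at p.2) p.2).

Lemma growthE j (t : R) x : 0 < t -> dom j x ->
  growth (t, x) = volume_growth j (t, coord j x).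
Proof.
move=> t0 jx; rewrite /growth /=; set i := chart_at x.
have ix : dom i x := dom_chart_at x.
have ov : overlap i j (coord i x).
  by split; [exact: coord_cod|rewrite coordK].
by rewrite (volume_growth_transition t0 ov) /transition coordK.
Qed.

Lemma growth_param i (t : R) z : 0 < t -> cod i z ->
  growth (t, param i z) = volume_growth i (t, z).
Proof.
move=> t0 iz; rewrite (growthE (j := i) t0); first by rewrite paramK.
exact: param_dom.
Qed.

Lemma continuous_growth (p : R^o * M) : 0 < p.1 -> {for p, continuous growth}.
Proof.
case: p => t x /= t0; set i := chart_at x.
have ix : dom i x := dom_chart_at x.
have cg : {for (t, x), continuous (fun p : R^o * M => volume_growth i (p.1, coord i p.2))}.
  apply: (@continuous_comp _ _ _ (fun p : R^o * M => (p.1, coord i p.2) : E)).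
    apply: (@cvg_pair _ _ _ (nbhs ((t, x) : R^o * M)) (nbhs t) (nbhs (coord i x))).
      exact: cvg_fst.
    apply: (@cvg_comp _ _ _ (@snd R^o M) (coord i) _ (nbhs x)); first exact: cvg_snd.
    exact: (Defs.coord_continuous ix).
  apply: (smooth_continuous (@smooth_volume_growth i)).
  by split => //; exact: coord_cod.
rewrite /prop_for /continuous_at in cg *.
rewrite (growthE (j := i) t0 ix); apply: cvg_trans cg.
apply: near_eq_cvg.
exists ([set s : R^o | 0 < s], dom i) => /=.
  split; first exact: lt_nbhsr.
  by apply: open_nbhs_nbhs; split => //; exact: dom_open.
by move=> [s y] [/= s0 iy]; rewrite (growthE (j := i) s0 iy).
Qed.

Hypothesis compactM : compact [set: M].
Hypothesis mu_ge0 : 0 <= mu.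

(** Maximum principle for v = (t - a) (growth - n mu) on [a, b] x M. As v = 0 at
    time a, a value above n is attained at a maximum (s, y) with s > a. There the
    complex Hessian of growth is nonpositive and the time derivative of v is
    nonnegative, even if s = b, and max_point_bound applies. *)
Lemma growth_bound (a b : R) (x : M) : 0 < a -> a <= b ->
  (b - a) * (growth (b, x) - n%:R * mu) <= n%:R.
Proof.
move=> a0 ab.
pose v (p : R^o * M) : R := (p.1 - a) * (growth p - n%:R * mu).
pose K : set (R^o * M) := `[a, b] `*` [set: M].
have cK : compact K by apply: compact_setX => //; exact: segment_compact.
have K0 : K !=set0 by exists (b, x); split => //=; rewrite in_itv /= ab lexx.
have cv : {within K, continuous v}.
  apply: continuous_in_subspaceT => p; rewrite inE => -[/= p1 _].
  have p0 : 0 < p.1 by move: p1; rewrite in_itv /= => /andP[/(lt_le_trans a0)].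
  apply: cvgM; last by apply: cvgB; [exact: continuous_growth|exact: cvg_cst].
  by apply: cvgB; [exact: cvg_fst|exact: cvg_cst].
have [[s y] Ksy vmax] := compact_EVT_max K0 cK cv.
have Kbx : (b, x) \in K by rewrite inE; split => //=; rewrite in_itv /= ab lexx.
apply: le_trans (vmax _ Kbx) _; rewrite leNgt; apply/negP => vbig.
move: Ksy; rewrite inE => -[/=]; rewrite in_itv /= => /andP[as_ sb] _.
have s0 : 0 < s := lt_le_trans a0 as_.
have n0 : (0 : R) <= n%:R by exact: ler0n.
have sa : 0 < s - a.
  rewrite lt_neqAle subr_ge0 as_ andbT; apply/negP => /eqP sa0.
  by move: vbig; rewrite /v /= -sa0 mul0r ltNge n0.
set i := chart_at y; have iy : dom i y := dom_chart_at y.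
set z := coord i y; have cz : cod i z := coord_cod iy.
have Sp : spacetime i (s, z) by [].
set w := volume_growth i (s, z).
have wE : growth (s, y) = w by rewrite (growthE (j := i) s0 iy).
have wmax (r : R) (y' : M) : a <= r <= b ->
    (r - a) * (growth (r, y') - n%:R * mu) <= (s - a) * (w - n%:R * mu).
  move=> rab; rewrite -wE; apply: (vmax (r, y')).
  by rewrite inE; split => //=; rewrite in_itv.
have space_max : \forall z' \near z, volume_growth i (s, z') <= w.
  apply: (open_near (@cod_open R n M A i) cz) => z' cz'.
  have sab : a <= s <= b by rewrite as_ sb.
  have := wmax s (param i z') sab; rewrite (growth_param s0 cz').
  by rewrite (ler_pM2l sa) lerD2r.
have Lap : Re (\tr (invmx (evolving i (s, z)) *m levi X Y (volume_growth i) (s, z))) <= 0.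
  apply: trace_negative; first exact: herm_pd_evolving.
  rewrite levi_space; apply: (levi_at_max _ _ (@cod_open R n M A i)) => //.
  have := smooth_slice s (@smooth_volume_growth i).
  by rewrite (_ : [set _ | _] = cod i)//; apply/seteqP; split => [? []|?].
have dw : is_derive (s : R^o) (1 : R^o) (fun r : R^o => volume_growth i (r, z))
     ('D_T (volume_growth i) (s, z)).
  apply/is_derive_time; apply: derivableP.
  exact: smooth_derivable (@smooth_volume_growth i) Sp.
have time_max : 0 <= (s - a) * 'D_T (volume_growth i) (s, z) + (w - n%:R * mu).
  pose g (r : R) : R := (r - a) * (volume_growth i (r, z) - n%:R * mu).
  have dg : is_derive s (1 : R) g ((s - a) * 'D_T (volume_growth i) (s, z) + (w - n%:R * mu)).
    have d1 : is_derive s (1 : R) (fun r : R => r - a) (1 - 0).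
      exact (is_deriveB (is_derive_id s (1 : R)) (is_derive_cst a s (1 : R))).
    have d2 : is_derive s (1 : R) (fun r : R => volume_growth i (r, z) - n%:R * mu)
        ('D_T (volume_growth i) (s, z) - 0).
      exact (is_deriveB dw (is_derive_cst (n%:R * mu) s (1 : R))).
    apply: is_derive_eq (is_deriveM d1 d2) _.
    by rewrite !subr0 [_ *: 1]mulr1.
  have [dg1 <-] := dg.
  have ltas : a < s by rewrite -subr_gt0.
  refine (derive_at_right_end_max ltas dg1 _) => r /andP[ar rs].
  have r0 : 0 < r := lt_le_trans a0 ar.
  have rab : a <= r <= b by rewrite ar (le_trans rs).
  by have := wmax r y rab; rewrite (growthE r0 iy).
have ineq := volume_growth_ineq Sp.
have vbig' : n%:R < (s - a) * (w - n%:R * mu) by rewrite -wE; exact: vbig.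
by have := max_point_bound n0 mu_ge0 sa Lap ineq time_max; rewrite leNgt vbig'.
Qed.

(** The flow equation says that Ric - (1 - gamma) th is mu g - dg/dt. *)
Lemma twisted_scalar_curvE i (t : R) z : 0 < t -> cod i z ->
  scalar_curv (deform omega0 (phi t) i) z
  - (1 - gamma) * tr_form (deform omega0 (phi t) i z) (th i z)
  = n%:R * mu - volume_growth i (t, z).
Proof.
move=> t0 cz; have Sp : spacetime i (t, z) by [].
have uG : evolving i (t, z) \in unitmx.
  by have [P []] := herm_pd_factor (herm_pd_evolving Sp).
rewrite (volume_growthE Sp) /scalar_curv /tr_form.
have -> : mxderive T (evolving i) (t, z) = - Ric_form (deform omega0 (phi t)) i z
     + mu%:C *: evolving i (t, z) + (1 - gamma)%:C *: th i z.
  apply/matrixP => a b; rewrite -flow_phi//.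
  by rewrite -(is_cderive_val (is_mxderive_evolving Sp a b)).
exact: re_trace_combination.
Qed.

End TwistedFlow.

Theorem lemma3p1 (R : realType) (n : nat) (M : ptopologicalType)
    (A : complex_atlas R n M) (hM : Fano A)
    (omega0 : form11 A) (homega0 : Kahler_metric omega0) (hc1 : in_c1 omega0)
    (lambda : rat) (p q : nat) (hq : (0 < q)%N)
    (hlambda : lambda = p%:R / q%:R) (hlambda1 : 1 < lambda)
    (D : set M) (sigma : chart A -> Cn R n -> R[i])
    (hD : smooth_divisor_in p q sigma D)
    (h : chart A -> Cn R n -> R) (hh : hermitian_metric (ratr lambda) h)
    (hcurv : forall i z, cod i z ->
       curvature h i z = (ratr lambda : R)%:C *: omega0 i z)
    (hs : forall i z, cod i z -> sqnorm q sigma h i z < 2^-1)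
    (phi0 : M -> R) (hcurrent : positive_current omega0 phi0)
    (r : R) (hr : 1 < r) (hdensity : Lp_density_full_mass omega0 phi0 r)
    (gamma : R) (hgamma : 1 - (ratr lambda)^-1 <= gamma <= 1)
    (hmu : 0 <= 1 - (1 - gamma) * ratr lambda <= 1)
    (eps : R) (heps : 0 < eps)
    (phi : R -> M -> R)
    (hphi : twisted_KRF_solution omega0 (1 - (1 - gamma) * ratr lambda) gamma
              (theta (ratr lambda) omega0 (sqnorm q sigma h) eps) phi0 phi)
    (t : R) (ht : 1 <= t) (i : chart A) (z : Cn R n) (hz : cod i z) :
  scalar_curv (deform omega0 (phi t) i) z
  - (1 - gamma) * tr_form (deform omega0 (phi t) i z)
      (theta (ratr lambda) omega0 (sqnorm q sigma h) eps i z)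
  >= - (4 * n%:R).
Proof.
have [compM _ _ _] := hM.
have [mu0 _] := andP hmu.
have [[smooth0 _ _] _ _] := homega0.
have [_ sphi Kphi fphi _] := hphi.
have t0 : 0 < t := lt_le_trans ltr01 ht.
rewrite (twisted_scalar_curvE smooth0 sphi Kphi fphi t0 hz).
(* any starting time a with 0 < a <= 3/4 would do, since then 1 / (1 - a) <= 4 *)
have half0 : 0 < 2^-1 :> R by rewrite invr_gt0 ltr0n.
have half_t : 2^-1 <= t by apply: le_trans ht; rewrite invf_le1 ?ltr0n// ler1n.
have := growth_bound smooth0 sphi Kphi fphi compM mu0 (param i z) half0 half_t.
rewrite (growth_param smooth0 sphi Kphi t0 hz).
move=> bound; rewrite -[leRHS]opprB; exact: bound_after_time_one (ler0n _ _) ht bound.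
Qed.
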